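(* For every integer $d\ge 1$ there exists a closed shift-invariant subset $X\subseteq\{0,1\}^{\mathbb{Z}^d}$ such that the $\mathbb{Z}^d$-shift action on $X$ is chaotic almost minimal (CAM) and supports at least two distinct nonatomic ergodic invariant Borel probability measures.
   Context: Let $G$ be a countable discrete group. A topological $G$-system $(X,T)$ consists of a compact metric space $X$ and an action $T\colon G\to\mathrm{Homeo}(X)$, $g\mapsto T_g$. The system is topologically transitive if for all nonempty open $U,V\subseteq X$ there is $g\in G$ with $T_gU\cap V\neq\emptyset$; the action is faithful if $T_g=\mathrm{id}_X$ only when $g$ is the identity. A point is periodic if its $G$-orbit is finite. The system is chaotic almost minimal (CAM) if: (1) it is topologically transitive and the action is faithful; (2) the periodic points are dense in $X$; (3) every proper closed $T$-invariant subset of $X$ is finite. The $\mathbb{Z}^d$-shift on $\{0,1\}^{\mathbb{Z}^d}$ (product topology) is $(\sigma_v x)(u)=x(u+v)$ for $u,v\in\mathbb{Z}^d$. *)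

(* Defs.v *)
From HB Require Import structures.
From mathcomp Require Import all_boot all_order all_algebra.
From mathcomp Require Import all_classical all_reals all_analysis.
Set Implicit Arguments. Unset Strict Implicit. Unset Printing Implicit Defensive.
Import Order.TTheory GRing.Theory Num.Theory.
Local Open Scope classical_set_scope.
Local Open Scope ring_scope.

Definition Zd (d : nat) := 'rV[int]_d.

Definition Conf (d : nat) := {ptws Zd d -> bool}.

Definition shift (d : nat) (v : Zd d) (x : Conf d) : Conf d :=
  fun u => x (u + v).

Definition shift_invariant (d : nat) (Y : set (Conf d)) : Prop :=
  forall v : Zd d, shift v @` Y `<=` Y.

(** Topological notions for the subsystem (X, shift|X); the topology on X is
    the subspace topology: relatively open sets are U `&` X with U open. *)
Definition sub_transitive (d : nat) (X : set (Conf d)) : Prop :=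
  forall U V : set (Conf d), open U -> open V ->
    U `&` X !=set0 -> V `&` X !=set0 ->
    exists g : Zd d, shift g @` (U `&` X) `&` (V `&` X) !=set0.

Definition sub_faithful (d : nat) (X : set (Conf d)) : Prop :=
  forall g : Zd d, (forall x, X x -> shift g x = x) -> g = 0.

Definition periodic_pt (d : nat) (x : Conf d) : Prop :=
  finite_set (range (fun g : Zd d => shift g x)).

Definition sub_dense_periodic (d : nat) (X : set (Conf d)) : Prop :=
  forall U : set (Conf d), open U -> U `&` X !=set0 ->
    exists2 x, (U `&` X) x & periodic_pt x.

(** Every proper closed invariant subset of X is finite.  Since X is closed,
    the closed subsets of X (subspace topology) are exactly the closed
    subsets of the ambient space contained in X. *)
Definition proper_closed_invariant_finite (d : nat) (X : set (Conf d)) : Prop :=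
  forall Y : set (Conf d), Y `<=` X -> Y <> X -> closed Y ->
    shift_invariant Y -> finite_set Y.

Definition CAM (d : nat) (X : set (Conf d)) : Prop :=
  [/\ sub_transitive X /\ sub_faithful X,
      sub_dense_periodic X &
      proper_closed_invariant_finite X].

Definition Borel (d : nat) := g_sigma_algebraType [set A : set (Conf d) | open A].

Definition bshift (d : nat) (v : Zd d) : Borel d -> Borel d := @shift d v.

Definition invariant_measure (d : nat) (R : realType)
    (mu : probability (Borel d) R) : Prop :=
  forall (v : Zd d) (A : set (Borel d)), measurable A ->
    mu (bshift v @^-1` A) = mu A.

Definition ergodic_measure (d : nat) (R : realType)
    (mu : probability (Borel d) R) : Prop :=
  forall A : set (Borel d), measurable A ->
    (forall v : Zd d, bshift v @^-1` A = A) ->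
    mu A = 0%E \/ mu A = 1%E.

Definition nonatomic_measure (d : nat) (R : realType)
    (mu : probability (Borel d) R) : Prop :=
  forall x : Borel d, mu [set x] = 0%E.

Definition supported_on (d : nat) (R : realType)
    (mu : probability (Borel d) R) (X : set (Conf d)) : Prop :=
  mu (X : set (Borel d)) = 1%E.

Definition nonatomic_ergodic_on (d : nat) (R : realType)
    (X : set (Conf d)) (mu : probability (Borel d) R) : Prop :=
  [/\ supported_on mu X, invariant_measure mu,
      ergodic_measure mu & nonatomic_measure mu].

(* Main.v *)
(* The configurations [conf n] are periodic with period [side n]: [conf 0] and
   [conf 1] are constant, and [conf n.+1] is [conf n.-1] except in [n.+1] sparse,
   pairwise non-adjacent cells of side [side n] per period, the [j]-th of which
   is filled with [conf j], for [j <= n].  The subshift is the closure of their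
   orbits.  At level [N] every point is tiled by cells of [conf j], [j <= N], and
   two adjacent cells carry the same [conf j] unless one of them is a cell of
   [conf N] or [conf N.-1]; those two contain every pattern of low level.  Hence
   a point avoiding a pattern is a translate of some [conf j] with [j < N.-1].

   Along the even and along the odd indices the sequence [conf n] is Cauchy for
   the density of the disagreement set, because the exceptional cells have
   summable density.  So the uniform measures on the orbits converge on
   cylinders; the limit extends to a Borel measure by compactness, and it is
   ergodic because box averages along the periodic orbits are exact.  The two
   limits are told apart by the frequency of the symbol 1. *)
Require Import Defs.
From HB Require Import structures.
From mathcomp Require Import all_boot all_order all_algebra.
From mathcomp Require Import all_classical all_reals all_analysis.
From mathcomp Require Import zify ring lra.
Set Implicit Arguments. Unset Strict Implicit. Unset Printing Implicit Defensive.
Import Order.TTheory GRing.Theory Num.Theory numFieldNormedType.Exports.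
Local Open Scope classical_set_scope.
Local Open Scope ring_scope.

(** * Cylinder sets and the product topology on configurations *)

Section topology.
Variable d : nat.
Implicit Types (C D : set (Conf d)) (W : seq (Zd d)).

Definition determined W C :=
  forall x y : Conf d, {in W, x =1 y} -> C x -> C y.

Definition cylinder C := exists W, determined W C.

Lemma determinedS W W' C : {subset W <= W'} -> determined W C -> determined W' C.
Proof. by move=> WW' dC x y xy; apply: dC => u /WW'; exact: xy. Qed.

Lemma determinedC W C : determined W C -> determined W (~` C).
Proof. by move=> dC x y xy nCx Cy; apply: nCx; apply: dC Cy => u /xy. Qed.

Lemma determinedU W C D :
  determined W C -> determined W D -> determined W (C `|` D).
Proof.
by move=> dC dD x y xy [Cx|Dx]; [left; exact: dC Cx|right; exact: dD Dx].
Qed.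

Lemma determined_shift W C v :
  determined W C -> determined [seq u + v | u <- W] (Defs.shift v @^-1` C).
Proof.
move=> dC x y xy /= Cx; apply: dC Cx => u uW.
by apply: xy; apply/mapP; exists u.
Qed.

Lemma cylinder0 : cylinder set0.
Proof. by exists [::]. Qed.

Lemma cylinderC C : cylinder C -> cylinder (~` C).
Proof. by move=> [W /determinedC dC]; exists W. Qed.

Lemma cylinderU C D : cylinder C -> cylinder D -> cylinder (C `|` D).
Proof.
move=> [W dC] [W' dD]; exists (W ++ W'); apply: determinedU.
  by apply: determinedS dC => u; rewrite mem_cat => ->.
by apply: determinedS dD => u; rewrite mem_cat orbC => ->.
Qed.

Lemma cylinderI C D : cylinder C -> cylinder D -> cylinder (C `&` D).
Proof.
move=> cC cD; rewrite -[C `&` D]setCK setCI.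
by apply/cylinderC/cylinderU; exact: cylinderC.
Qed.

Lemma cylinder_shift C v : cylinder C -> cylinder (Defs.shift v @^-1` C).
Proof. by move=> [W /determined_shift dC]; eexists; exact: dC. Qed.

Lemma nbhs_agree (x : Conf d) W :
  nbhs x [set y : Conf d | {in W, x =1 y}].
Proof.
elim: W => [|u W IH]; first by apply: filterS filterT => y _ u.
have nu : nbhs x [set y : Conf d | x u = y u].
  have nb : nbhs (x u : bool) [set b : bool | x u = b].
    by rewrite nbhs_principalE; apply/principal_filterP.
  exact: (@proj_continuous _ (fun _ : Zd d => bool) u x _ nb).
near=> y => /= v; rewrite inE => /orP[/eqP ->|]; last first.
  by move: v; near: y.
by near: y.
Unshelve. all: by end_near. Qed.

(** The sets that contain an agreement cylinder at [x] form a filter, and it converges to [x]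
    because it does so in each coordinate of the product topology. *)
Lemma nbhs_agreeP (x : Conf d) (U : set (Conf d)) :
  nbhs x U -> exists W, forall y, {in W, x =1 y} -> U y.
Proof.
pose F : set_system (Conf d) := [set U | exists W, forall y, {in W, x =1 y} -> U y].
have FF : Filter F.
  split.
  - by exists [::].
  - move=> P Q [W WP] [W' WQ]; exists (W ++ W') => y xy; split.
      by apply: WP => u uW; apply: xy; rewrite mem_cat uW.
    by apply: WQ => u uW; apply: xy; rewrite mem_cat uW orbT.
  - by move=> P Q PQ [W WP]; exists W => y /WP/PQ.
have Fx : F --> x.
  apply/cvg_sup => u A [V] [[B _ <-]] Bx VA; apply: filterS VA _.
  exists [:: u] => y xy; move: Bx; rewrite /preimage /= /proj.
  by rewrite xy ?inE.
by move=> /Fx.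
Qed.

Lemma determined_open W C : determined W C -> open C.
Proof.
move=> dC; rewrite openE => x Cx; apply: filterS (nbhs_agree x W) => y xy.
exact: dC Cx.
Qed.

Lemma cylinder_open C : cylinder C -> open C.
Proof. by move=> [W]; exact: determined_open. Qed.

Lemma cylinder_closed C : cylinder C -> closed C.
Proof. by move=> /cylinderC/cylinder_open; rewrite -closedC setCK. Qed.

Lemma Conf_compact : compact [set: Conf d].
Proof.
have := @tychonoff _ (fun _ : Zd d => bool) _ (fun=> bool_compact).
by congr (compact _); rewrite eqEsubset.
Qed.

Lemma cylinder_compact C : cylinder C -> compact C.
Proof.
move=> /cylinder_closed cC.
exact: subclosed_compact cC Conf_compact (@subsetT _ _).
Qed.

(** The union is compact and covered by disjoint open sets, so all but finitely many are empty. This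
    reduces sigma-additivity on cylinders to finite additivity. *)
Lemma cylinder_trivIset (F : nat -> set (Conf d)) : (forall n, cylinder (F n)) ->
  trivIset setT F -> cylinder (\bigcup_n F n) ->
  exists N, forall i, (N <= i)%N -> F i = set0.
Proof.
move=> cF tF /cylinder_compact/compact_near_coveringP cU.
have [] := cU nat \oo (fun N x => forall i, (N <= i)%N -> ~ F i x) _.
  move=> x [j _ Fjx]; near=> y N.
  have Fjy : F j y by near: y; apply: open_nbhs_nbhs; split => //; exact: cylinder_open.
  have jN : (j < N)%N by near: N; exists j.+1.
  move=> i Ni Fiy.
  have ij : i = j by apply: tF => //; exists y.
  by move: Ni; rewrite ij leqNgt jN.
move=> N _ FN; exists N => i Ni; apply/seteqP; split => // x Fix.
by case: (FN N (leqnn N) x _ i Ni) => //; exists i.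
Unshelve. all: by end_near. Qed.

Definition basic (s : seq (Zd d * bool)) : set (Conf d) :=
  [set x | {in s, forall p, x p.1 = p.2}].

Lemma cylinder_basic s : cylinder (basic s).
Proof.
exists (map fst s) => x y xy bx p ps; rewrite -xy ?bx//.
by apply/mapP; exists p.
Qed.

Lemma open_bigcup_cylinder (U : set (Conf d)) : open U ->
  exists2 F : nat -> set (Conf d), forall n, cylinder (F n) & U = \bigcup_n F n.
Proof.
move=> oU.
(* Finite lists of prescribed coordinates are countable; an index that decodes to no list, or to one
   whose cylinder leaves [U], contributes the empty set. *)
exists (fun n => if unpickle n is Some s then
  if `[< basic s `<=` U >] then basic s else set0 else set0).
  move=> n; case: unpickle => [s|]; last exact: cylinder0.
  by case: ifP => _; [exact: cylinder_basic|exact: cylinder0].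
apply/seteqP; split=> [x Ux|x [n _]]; last first.
  by case: unpickle => // s; case: asboolP => // sU /sU.
have [W WU] := nbhs_agreeP (open_nbhs_nbhs (conj oU Ux)).
exists (pickle [seq (u, x u) | u <- W]) => //; rewrite pickleK asboolT.
  by move=> p /mapP[u _ ->].
move=> y /= b; apply: WU => u uW.
by rewrite (b (u, x u))//; apply/mapP; exists u.
Qed.

Lemma shift_continuous v : continuous (@Defs.shift d v).
Proof.
move=> x U /= /nbhs_agreeP[W WU].
apply: filterS (nbhs_agree x [seq u + v | u <- W]) => y xy; apply: WU => u uW.
by apply: xy; apply/mapP; exists u.
Qed.

Lemma Conf_shift0 (x : Conf d) : Defs.shift 0 x = x.
Proof. by apply/funext => u; rewrite /Defs.shift addr0. Qed.

Lemma shiftD v w (x : Conf d) :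
  Defs.shift v (Defs.shift w x) = Defs.shift (v + w) x.
Proof. by apply/funext => u; rewrite /Defs.shift addrA. Qed.

Lemma shiftK v : cancel (@Defs.shift d v) (Defs.shift (- v)).
Proof. by move=> x; rewrite shiftD addNr Conf_shift0. Qed.

End topology.

(** * Box averages and densities of periodic functions on the lattice *)

Section averages.
Variables (R : realType) (d : nat).
Implicit Types (L M : nat) (f g : Zd d -> R) (t u v : Zd d).

Definition lattice_periodic (T : Type) L (f : Zd d -> T) :=
  forall t u, f (t + u *+ L) = f t.

(** The form [L.-1.+1] makes the index type a nonempty cyclic group, so that for [L > 0] the box is
    the quotient of the lattice by its multiples of [L]. *)
Definition box L := 'rV['I_L.-1.+1]_d.

Definition corner L (v : box L) : Zd d := map_mx (fun i : 'I_L.-1.+1 => (i : nat)%:Z) v.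

Definition avg L f : R := (\sum_(v : box L) f (corner v)) / #|{: box L}|%:R.

Lemma card_box L : (0 < L)%N -> #|{: box L}| = (L ^ d)%N.
Proof. by move=> L0; rewrite card_mx card_ord mul1n prednK. Qed.

Lemma card_box_gt0 L : 0 < #|{: box L}|%:R :> R.
Proof. by rewrite ltr0n; apply/card_gt0P; exists 0. Qed.

Lemma avgD L f g : avg L (fun t => f t + g t) = avg L f + avg L g.
Proof. by rewrite /avg big_split mulrDl. Qed.

Lemma avgZ L a f : avg L (fun t => a * f t) = a * avg L f.
Proof. by rewrite /avg -mulr_sumr mulrA. Qed.

Lemma avgN L f : avg L (fun t => - f t) = - avg L f.
Proof. by rewrite /avg sumrN mulNr. Qed.

Lemma avgB L f g : avg L (fun t => f t - g t) = avg L f - avg L g.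
Proof. by rewrite avgD avgN. Qed.

Lemma avg_sum (I : Type) (r : seq I) L (F : I -> Zd d -> R) :
  avg L (fun t => \sum_(i <- r) F i t) = \sum_(i <- r) avg L (F i).
Proof. by rewrite /avg exchange_big mulr_suml. Qed.

Lemma avg_cst L a : avg L (fun=> a) = a.
Proof.
rewrite /avg sumr_const -[a *+ _]mulr_natr mulfK// gt_eqF//.
exact: card_box_gt0.
Qed.

Lemma eq_avg L f g : f =1 g -> avg L f = avg L g.
Proof. by move=> fg; rewrite /avg; congr (_ / _); apply: eq_bigr. Qed.

Lemma ler_avg L f g : (forall t, f t <= g t) -> avg L f <= avg L g.
Proof.
move=> fg; rewrite /avg ler_pM2r ?invr_gt0 ?card_box_gt0//.
by apply: ler_sum => v _.
Qed.

Lemma avg_ge0 L f : (forall t, 0 <= f t) -> 0 <= avg L f.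
Proof. by move=> f0; rewrite -(avg_cst L 0); exact: ler_avg. Qed.

Lemma ler_norm_avg L f : `|avg L f| <= avg L (fun t => `|f t|).
Proof.
rewrite /avg normrM [`|_^-1|]ger0_norm ?invr_ge0 ?ler0n//.
by rewrite ler_pM2r ?invr_gt0 ?card_box_gt0// ler_norm_sum.
Qed.

Lemma exchange_avg L M (F : Zd d -> Zd d -> R) :
  avg L (fun t => avg M (F t)) = avg M (fun u => avg L (F^~ u)).
Proof.
rewrite /avg -!mulr_suml exchange_big /= !mulr_suml; apply: eq_bigr => v _.
by rewrite -!mulrA; congr (_ * _); exact: mulrC.
Qed.

Lemma periodic_dvd (T : Type) L M (f : Zd d -> T) :
  (L %| M)%N -> lattice_periodic L f -> lattice_periodic M f.
Proof. by move=> /dvdnP[k ->] pf t u; rewrite mulrnA. Qed.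

Lemma mod_box L u : (0 < L)%N ->
  exists w : box L, exists a : Zd d, u = corner w + a *+ L.
Proof.
move=> L0; pose m (i : 'I_d) := (u ord0 i %% L)%Z.
exists (\row_i inord `|m i|%N), (\row_i (u ord0 i %/ L)%Z).
apply/rowP => i; rewrite !mxE mulmxnE !mxE inordK; last first.
  rewrite prednK// -ltz_nat gez0_abs ?modz_ge0 ?ltz_pmod//; lia.
rewrite gez0_abs; last by rewrite modz_ge0//; lia.
by rewrite {1}(divz_eq (u ord0 i) L) addrC -mulr_natr natz.
Qed.

Lemma cornerD L (v w : box L) : (0 < L)%N ->
  exists a : Zd d, corner v + corner w = corner (v + w) + a *+ L.
Proof.
move=> L0.
exists (\row_i (((v ord0 i + w ord0 i) %/ L)%N%:Z)).
apply/rowP => i; rewrite !mxE mulmxnE !mxE /=.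
move: (nat_of_ord _) (nat_of_ord _) => a b; rewrite prednK//.
rewrite -mulr_natr natz -PoszM -!PoszD; congr Posz.
by rewrite [LHS](divn_eq _ L) addnC.
Qed.

(** Modulo the period, translation by [u] is a translation of the group [box L], hence a reindexing
    of the sum. *)
Lemma avg_shift L f u : (0 < L)%N -> lattice_periodic L f ->
  avg L (fun t => f (t + u)) = avg L f.
Proof.
move=> L0 pf; rewrite /avg; congr (_ / _).
have [w [a ->]] := mod_box u L0.
rewrite [RHS](reindex_inj (@addIr _ w)); apply: eq_bigr => v _.
by have [b bE] := cornerD v w L0; rewrite addrA pf bE pf.
Qed.

(** Both sides equal the double average of [f (u + t)] over the two boxes, by translation invariance
    in either variable. *)
Lemma avg_period L M f : (0 < L)%N -> (0 < M)%N ->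
  lattice_periodic L f -> lattice_periodic M f -> avg L f = avg M f.
Proof.
move=> L0 M0 pL pM.
rewrite -[RHS](avg_cst L) -[LHS](avg_cst M).
rewrite (@eq_avg M (fun=> avg L f) (fun t => avg L (fun u => f (u + t)))); last first.
  by move=> t; rewrite avg_shift.
rewrite exchange_avg; apply: eq_avg => t.
by under eq_avg do rewrite addrC; rewrite avg_shift.
Qed.

Lemma avg_ge_point L f t : (0 < L)%N -> lattice_periodic L f -> (forall u, 0 <= f u) ->
  f t / #|{: box L}|%:R <= avg L f.
Proof.
move=> L0 pf f0; rewrite /avg ler_pM2r ?invr_gt0 ?card_box_gt0//.
have [w [a ->]] := mod_box t L0.
by rewrite pf (bigD1 w)//= lerDl sumr_ge0.
Qed.

Definition dens L (P : Zd d -> bool) : R := avg L (fun t => (P t)%:R).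

Lemma dens_ge0 L P : 0 <= dens L P.
Proof. by apply: avg_ge0 => t; rewrite ler0n. Qed.

Lemma le_dens L (P Q : Zd d -> bool) : (forall t, P t -> Q t) -> dens L P <= dens L Q.
Proof.
move=> PQ; apply: ler_avg => t; rewrite ler_nat; move: (PQ t).
by case: (P t) => // ->.
Qed.

Lemma densU L (P Q : Zd d -> bool) :
  dens L (fun t => P t || Q t) <= dens L P + dens L Q.
Proof.
rewrite /dens -avgD; apply: ler_avg => t.
by rewrite -natrD ler_nat; case: (P t); case: (Q t).
Qed.

Lemma dens_has (I : Type) (r : seq I) L (P : I -> Zd d -> bool) :
  dens L (fun t => has (P^~ t) r) <= \sum_(i <- r) dens L (P i).
Proof.
elim: r => [|i r IH]; first by rewrite big_nil /dens avg_cst.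
rewrite big_cons /=; apply: le_trans (densU _ _ _) _.
by rewrite lerD2l.
Qed.

Lemma dens_shift L P u : (0 < L)%N -> lattice_periodic L P ->
  dens L (fun t => P (t + u)) = dens L P.
Proof.
by move=> L0 pP; apply: (avg_shift _ L0 (f := fun t => (P t)%:R)) => v t; rewrite pP.
Qed.

Lemma dens_period L M P : (0 < L)%N -> (0 < M)%N ->
  lattice_periodic L P -> lattice_periodic M P -> dens L P = dens M P.
Proof.
by move=> L0 M0 pL pM; apply: avg_period => // t u; rewrite ?pL ?pM.
Qed.

Lemma dens_neq_triangle L (x y z : Zd d -> bool) :
  dens L (fun t => x t != z t) <=
  dens L (fun t => x t != y t) + dens L (fun t => y t != z t).
Proof.
apply: le_trans (densU _ _ _); apply: le_dens => t.
by case: (x t); case: (y t); case: (z t).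
Qed.

End averages.

(** * From finitely additive contents on cylinders to Borel probabilities *)

Section cylinder_algebra.
Variable d : nat.

Definition cylinder_type := Conf d.

Definition cylinder_display : measure_display. Proof. exact: default_measure_display. Qed.

HB.instance Definition _ := Pointed.on cylinder_type.
HB.instance Definition _ := @isAlgebraOfSets.Build cylinder_display
  cylinder_type (@cylinder d) (@cylinder0 d) (@cylinderU d) (@cylinderC d).

Lemma sigma_open_cylinder :
  <<s [set A : set (Conf d) | open A] >> = <<s @cylinder d >>.
Proof.
apply/seteqP; split; apply: smallest_sub => //;
  try exact: smallest_sigma_algebra.
- move=> U oU; have [F cF ->] := open_bigcup_cylinder oU.
  apply: (@bigcupT_measurable _ (g_sigma_algebraType (@cylinder d))) => n.
  exact: sub_sigma_algebra.
- by move=> C cC; apply: sub_sigma_algebra; exact: cylinder_open.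
Qed.

Lemma cylinder_measurable (C : set (Borel d)) : cylinder C -> measurable C.
Proof. by move=> cC; apply: sub_sigma_algebra; exact: cylinder_open. Qed.

Lemma open_measurable_Borel (U : set (Borel d)) :
  open (U : set (Conf d)) -> measurable U.
Proof. by move=> oU; exact: sub_sigma_algebra. Qed.

Lemma closed_measurable_Borel (F : set (Borel d)) :
  closed (F : set (Conf d)) -> measurable F.
Proof.
move=> cF; rewrite -[F]setCK; apply: measurableC.
by apply: open_measurable_Borel; exact: closed_openC.
Qed.

Section extension.
Variables (R : realType) (m : set (Conf d) -> R).
Hypothesis m_ge0 : forall C, cylinder C -> 0 <= m C.
Hypothesis mT : m setT = 1.
Hypothesis mU : forall C D, cylinder C -> cylinder D -> C `&` D = set0 ->
  m (C `|` D) = m C + m D.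

(* The norm only forces nonnegativity outside the cylinder sets, where [m] is
   unconstrained. *)
Definition cylinder_content (C : set cylinder_type) : \bar R := `|m C|%:E.

Local Lemma content_ge0 C : (0 <= cylinder_content C)%E.
Proof. by rewrite lee_fin. Qed.

Local Lemma m_set0 : m set0 = 0.
Proof.
have := mU (@cylinder0 d) (@cylinder0 d) (setI0 _).
by rewrite setU0 -[X in X = _]addr0 => /addrI.
Qed.

Local Lemma content0 : cylinder_content set0 = 0%E.
Proof. by rewrite /cylinder_content m_set0 normr0. Qed.

Local Lemma contentE (C : set cylinder_type) :
  cylinder C -> cylinder_content C = (m C)%:E.
Proof. by move=> cC; rewrite /cylinder_content ger0_norm ?m_ge0. Qed.

Local Lemma content_additive2 : measure_function.semi_additive2 cylinder_content.
Proof.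
by move=> A B cA cB cAB AB; rewrite !contentE// mU.
Qed.

Local Lemma content_additive : measure_function.semi_additive cylinder_content.
Proof.
apply/(additive2P content0); rewrite -semi_additive2E.
exact: content_additive2.
Qed.

Local Lemma content_sigma_additive : semi_sigma_additive cylinder_content.
Proof.
move=> F cF tF cUF.
have [N FN] := cylinder_trivIset cF tF cUF.
rewrite (_ : \bigcup_n F n = \big[setU/set0]_(i < N) F i); last first.
  rewrite (bigcup_splitn N) bigcup0 ?setU0// => i _.
  by apply: FN; rewrite leq_addr.
rewrite content_additive//; last 1 first.
  exact: bigsetU_measurable.
apply: cvg_near_cst; exists N => //= n Nn.
rewrite (@big_cat_nat _ _ _ N)//= [X in (_ + X)%E]big_nat_cond.
rewrite [X in (_ + X)%E]big1 ?adde0 ?big_mkord// => i /andP[/andP[Ni _] _].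
by rewrite FN// content0.
Qed.

HB.instance Definition _ := isMeasure.Build cylinder_display cylinder_type R
  cylinder_content content0 content_ge0 content_sigma_additive.

(** The Carathéodory extension lives on the sigma-algebra generated by cylinders; it is retyped over
    [Borel d], whose sigma-algebra is the same by [sigma_open_cylinder]. *)
Definition Borel_extension (A : set (Borel d)) : \bar R :=
  measure_extension cylinder_content A.

Local Lemma Borel_extension0 : Borel_extension set0 = 0%E.
Proof. exact: measure0. Qed.

Local Lemma Borel_extension_ge0 A : (0 <= Borel_extension A)%E.
Proof. exact: measure_ge0. Qed.

Local Lemma Borel_extension_sigma_additive :
  semi_sigma_additive Borel_extension.
Proof.
have mE (A : set (Borel d)) : measurable A -> <<s @cylinder d >> A.
  by rewrite -sigma_open_cylinder.
move=> F mF tF mUF.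
pose I := g_sigma_algebraType (@measurable _ cylinder_type).
pose nu : {measure set I -> \bar R} := measure_extension cylinder_content.
exact: (@measure_semi_sigma_additive _ _ _ nu F (fun i => mE _ (mF i)) tF (mE _ mUF)).
Qed.

HB.instance Definition _ := isMeasure.Build _ _ _ Borel_extension
  Borel_extension0 Borel_extension_ge0 Borel_extension_sigma_additive.

Local Lemma Borel_extension_cylinder C : cylinder C -> Borel_extension C = (m C)%:E.
Proof.
move=> cC; rewrite /Borel_extension /measure_extension measurable_mu_extE//.
exact: contentE.
Qed.

Local Lemma Borel_extensionT : Borel_extension setT = 1%E.
Proof.
by rewrite Borel_extension_cylinder ?mT// -setC0; exact/cylinderC/cylinder0.
Qed.

HB.instance Definition _ :=
  @Measure_isProbability.Build _ _ _ Borel_extension Borel_extensionT.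

Lemma cylinder_extension : exists mu : probability (Borel d) R,
  forall C, cylinder C -> mu C = (m C)%:E.
Proof. by exists Borel_extension; exact: Borel_extension_cylinder. Qed.

End extension.
End cylinder_algebra.

(** * Real-valued probabilities and symmetric differences *)

Definition symdiff (T : Type) (A B : set T) := (A `\` B) `|` (B `\` A).

Section real_probability.
Variables (R : realType) (dsp : measure_display) (T : measurableType dsp).
Variable mu : probability T R.
Implicit Types A B : set T.

Definition pr (A : set T) : R := fine (mu A).

Lemma prE A : measurable A -> mu A = (pr A)%:E.
Proof. by move=> mA; rewrite fineK// fin_num_measure. Qed.

Lemma pr_ge0 A : 0 <= pr A.
Proof. by rewrite fine_ge0. Qed.

Lemma pr_le1 A : measurable A -> pr A <= 1.
Proof. by move=> mA; rewrite -lee_fin -prE// probability_le1. Qed.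

Lemma le_pr A B : measurable A -> measurable B -> A `<=` B -> pr A <= pr B.
Proof. by move=> mA mB AB; rewrite -lee_fin -!prE// le_measure// inE. Qed.

Lemma prU_le A B : measurable A -> measurable B ->
  pr (A `|` B) <= pr A + pr B.
Proof.
move=> mA mB; rewrite -lee_fin EFinD -!prE//; last exact: measurableU.
exact: measureU2.
Qed.

Lemma prU A B : measurable A -> measurable B -> A `&` B = set0 ->
  pr (A `|` B) = pr A + pr B.
Proof.
move=> mA mB AB; apply/EFin_inj; rewrite EFinD -!prE//; last exact: measurableU.
exact: measureU.
Qed.

Lemma prDI A B : measurable A -> measurable B ->
  pr A = pr (A `\` B) + pr (A `&` B).
Proof.
move=> mA mB; apply/EFin_inj; rewrite EFinD -!prE//.
- exact: measureDI.
- exact: measurableI.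
- exact: measurableD.
Qed.

Lemma measurable_symdiff A B :
  measurable A -> measurable B -> measurable (symdiff A B).
Proof. by move=> mA mB; apply: measurableU; exact: measurableD. Qed.

Lemma pr_dist A B : measurable A -> measurable B ->
  `|pr A - pr B| <= pr (symdiff A B).
Proof.
move=> mA mB; rewrite (prDI mA mB) (prDI mB mA) [B `&` A]setIC.
rewrite opprD addrACA subrr addr0 ler_norml.
have mS := measurable_symdiff mA mB.
have h1 : pr (A `\` B) <= pr (symdiff A B).
  by apply: le_pr => //; [exact: measurableD|left].
have h2 : pr (B `\` A) <= pr (symdiff A B).
  by apply: le_pr => //; [exact: measurableD|right].
have := pr_ge0 (A `\` B); have := pr_ge0 (B `\` A); lra.
Qed.

Lemma pr_bigcup_tail (F : nat -> set T) (eps : R) :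
  (forall n, measurable (F n)) -> 0 < eps ->
  exists n, pr ((\bigcup_n F n) `\` \big[setU/set0]_(i < n) F i) < eps.
Proof.
move=> mF eps0; pose G n := \big[setU/set0]_(i < n.+1) F i.
have mG n : measurable (G n) by apply: bigsetU_measurable.
have mU : measurable (\bigcup_n F n) by exact: bigcupT_measurable.
have GU : \bigcup_n G n = \bigcup_n F n by exact: bigcup_bigsetU_bigcup.
have GF n : G n `<=` \bigcup_n F n by rewrite -GU; exact: bigcup_sup.
have : (mu \o G) @ \oo --> (pr (\bigcup_n F n))%:E.
  rewrite -prE// -GU; apply: nondecreasing_cvg_mu => //; rewrite ?GU//.
  by move=> n m nm; apply/subsetPset; exact: (@subset_bigsetU _ F n.+1 m.+1).
move=> /fine_cvg /cvgr_dist_lt /(_ _ eps0) [N _ /(_ N (leqnn N))] /= h.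
exists N.+1; apply: le_lt_trans h; rewrite (prDI mU (mG N)).
rewrite (_ : (\bigcup_n F n) `&` \big[setU/set0]_(i < N.+1) F i = G N); last first.
  by rewrite setIidr//; exact: GF.
by rewrite /pr addrK ler_norm.
Qed.

End real_probability.

(** * Approximation of Borel sets by cylinders *)

Section approximation.
Variables (R : realType) (d : nat) (mu : probability (Borel d) R).

(** The sets that cylinders approximate form a sigma-algebra containing the cylinders; a countable
    union is first cut to a finite one at cost [eps / 2]. *)
Lemma cylinder_approx (A : set (Borel d)) (eps : R) :
  measurable A -> 0 < eps ->
  exists2 C : set (Conf d), cylinder C & pr mu (symdiff A C) < eps.
Proof.
pose G := [set A : set (Borel d) | measurable A /\ forall eps : R, 0 < eps ->
  exists2 C : set (Conf d), cylinder C & pr mu (symdiff A C) < eps].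
have GU A1 A2 : G A1 -> G A2 -> G (A1 `|` A2).
  move=> [mA1 h1] [mA2 h2]; split; first exact: measurableU.
  move=> e e0; have e20 : 0 < e / 2 by lra.
  have [C1 cC1 l1] := h1 _ e20; have [C2 cC2 l2] := h2 _ e20.
  have mC1 := cylinder_measurable cC1; have mC2 := cylinder_measurable cC2.
  exists (C1 `|` C2); first exact: cylinderU.
  have mS1 := measurable_symdiff mA1 mC1; have mS2 := measurable_symdiff mA2 mC2.
  have : pr mu (symdiff (A1 `|` A2) (C1 `|` C2)) <=
      pr mu (symdiff A1 C1 `|` symdiff A2 C2).
    apply: le_pr; [|exact: measurableU|].
      by apply: measurable_symdiff; exact: measurableU.
    move=> x [[[xA|xA] /not_orP[n1 n2]]|[[xA|xA] /not_orP[n1 n2]]].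
    - by left; left.
    - by right; left.
    - by left; right.
    - by right; right.
  by have := prU_le mu mS1 mS2; lra.
have G0 : G set0.
  split => // e e0; exists set0; first exact: cylinder0.
  by rewrite /symdiff !setD0 setU0 /pr measure0.
suff sub : <<s [set A : set (Conf d) | open A] >> `<=` G.
  by move=> mA; apply: (sub _ mA).2.
rewrite sigma_open_cylinder; apply: smallest_sub; last first.
  move=> C cC; split; first exact: cylinder_measurable.
  by move=> e e0; exists C => //; rewrite /symdiff !setDv setU0 /pr measure0.
split => //.
- move=> B [mB h]; rewrite setTD; split; first exact: measurableC.
  move=> e /h[C cC l]; exists (~` C); first exact: cylinderC.
  by rewrite /symdiff !setDE !setCK setUC [C `&` _]setIC [B `&` _]setIC in l *.
- move=> F GF; have mF n : measurable (F n : set (Borel d)) by have [] := GF n.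
  have mU : measurable (\bigcup_n F n : set (Borel d)) by exact: bigcupT_measurable.
  split=> // e e0; have e20 : 0 < e / 2 by lra.
  have [n ln] := pr_bigcup_tail mu mF e20.
  have [mS] : G (\big[setU/set0]_(i < n) F i).
    by elim/big_ind: _ => // i _; exact: GF.
  move=> /(_ _ e20)[C cC lC]; exists C => //.
  have mC := cylinder_measurable cC.
  have mD := measurableD mU mS; have mSC := measurable_symdiff mS mC.
  have := prU_le mu mD mSC.
  set D : set (Borel d) := _ `\` _; set S : set (Borel d) := symdiff _ C => DS.
  suff : pr mu (symdiff (\bigcup_n F n) C) <= pr mu (D `|` S).
    by rewrite -/D in ln; lra.
  apply: le_pr; [exact: measurable_symdiff|exact: measurableU|].
  have SU : \big[setU/set0]_(i < n) F i `<=` \bigcup_n F n.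
    exact: bigsetU_bigcup.
  move=> x [[xU xC]|[xC xU]]; last by right; right; split => // /SU.
  have [xS|xS] := pselect ((\big[setU/set0]_(i < n) F i) x).
    by right; left.
  by left.
Qed.

End approximation.

(** * Ergodic measures as limits of periodic orbit measures *)

Section besicovitch_limits.
Variables (R : realType) (d : nat).
Implicit Types (x y : Conf d) (C E F : set (Conf d)) (W : seq (Zd d)).

(** For an [L]-periodic [x] with [L > 0], this is the mass of [C] under the uniform measure on the
    orbit of [x]. *)
Definition occ (L : nat) x C : R := dens R L (fun t => `[< C (Defs.shift t x) >]).

Lemma periodic_occ (L : nat) x C : lattice_periodic L (x : Zd d -> bool) ->
  lattice_periodic L (fun t => `[< C (Defs.shift t x) >]).
Proof.
move=> px t u; congr `[< C _ >]; apply/funext => v.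
by rewrite /Defs.shift addrA px.
Qed.

Lemma occ_ge0 L x C : 0 <= occ L x C.
Proof. exact: dens_ge0. Qed.

Lemma occU L x E F : E `&` F = set0 -> occ L x (E `|` F) = occ L x E + occ L x F.
Proof.
move=> EF; rewrite /occ /dens -avgD; apply: eq_avg => t.
rewrite asbool_or -natrD; case: asboolP => // Ex; case: asboolP => // Fx.
by have : (E `&` F) (Defs.shift t x); [split|rewrite EF].
Qed.

Lemma occ_preimage_shift L x C v : (0 < L)%N -> lattice_periodic L (x : Zd d -> bool) ->
  occ L x (Defs.shift v @^-1` C) = occ L x C.
Proof.
move=> L0 px; rewrite /occ -[RHS](dens_shift R v L0 (periodic_occ C px)).
by apply: eq_avg => t; rewrite /preimage /= shiftD addrC.
Qed.

(** An effective Cauchy condition for the Besicovitch pseudometric: [e k] controls the distance from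
    [p k] to every later term. Divisibility of the periods lets two terms be compared on one box. *)
Record besicovitch_cauchy (p : nat -> Conf d) (L : nat -> nat) (e : nat -> R) :
    Prop := {
  period_gt0 : forall k, (0 < L k)%N;
  period_dvd : forall k m, (k <= m)%N -> (L k %| L m)%N;
  periodic_seq : forall k, lattice_periodic (L k) (p k : Zd d -> bool);
  dens_dist : forall k m, (k <= m)%N ->
    dens R (L m) (fun t => p k t != p m t) <= e k;
  dist_cvg0 : e @ \oo --> 0 }.

Variables (p : nat -> Conf d) (L : nat -> nat) (e : nat -> R).
Hypothesis pLe : besicovitch_cauchy p L e.

Let L0 k : (0 < L k)%N. Proof. exact: (period_gt0 pLe). Qed.
Let pL k : lattice_periodic (L k) (p k : Zd d -> bool).
Proof. exact: (periodic_seq pLe). Qed.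
Let pLm k m : (k <= m)%N -> lattice_periodic (L m) (p k : Zd d -> bool).
Proof. by move=> km; apply: periodic_dvd (pL k); exact: (period_dvd pLe). Qed.

Lemma occ_dvd k m C : (k <= m)%N -> occ (L k) (p k) C = occ (L m) (p k) C.
Proof.
move=> km; apply: dens_period => //; apply: periodic_occ => //.
exact: pLm.
Qed.

(** The indicators differ at [t] only if [p k] and [p m] differ at some [t + w] with [w] in [W];
    this is the union bound over the window. *)
Lemma avg_indicator_dist k m C W : determined W C -> (k <= m)%N ->
  avg (L m) (fun t => `| (`[< C (Defs.shift t (p m)) >])%:R -
                         (`[< C (Defs.shift t (p k)) >])%:R : R |)
  <= (size W)%:R * e k.
Proof.
move=> dC km.
apply: (@le_trans _ _ (\sum_(w <- W) dens R (L m) (fun t => (fun s => p k s != p m s) (t + w)))).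
  apply: le_trans (dens_has _ _ _ _); apply: ler_avg => t.
  have [agree|] := boolP (has (fun w => p k (t + w) != p m (t + w)) W).
    by case: asboolP => _; case: asboolP => _; rewrite ?subrr ?subr0 ?sub0r ?normrN ?normr0 ?normr1 ?ler01.
  move=> /hasPn agree; suff -> : C (Defs.shift t (p m)) = C (Defs.shift t (p k)).
    by rewrite subrr normr0.
  apply/propext; split; apply: dC => w /agree/negPn/eqP;
    by rewrite /Defs.shift addrC => ->.
rewrite mulr_natl -iter_addr_0 -count_predT -big_const_seq; apply: ler_sum => w _.
rewrite (@dens_shift R d (L m) (fun s => p k s != p m s) w)//.
  exact: (dens_dist pLe).
by move=> t u; rewrite (pLm km) pL.
Qed.

Lemma occ_dist k m C W : determined W C -> (k <= m)%N ->
  `|occ (L m) (p m) C - occ (L k) (p k) C| <= (size W)%:R * e k.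
Proof.
move=> dC km; rewrite (occ_dvd C km) /occ /dens -avgB.
exact: le_trans (ler_norm_avg _ _) (avg_indicator_dist dC km).
Qed.

Lemma occ_cvg C : cylinder C -> cvg ((fun k => occ (L k) (p k) C) @ \oo).
Proof.
move=> [W dC]; apply: cauchy_cvg; apply: cauchy_exP => eps eps0.
have : (fun k => (size W)%:R * e k) @ \oo --> (0 : R).
  by rewrite -(mulr0 (size W)%:R); apply: cvgM; [exact: cvg_cst|exact: (dist_cvg0 pLe)].
move=> /cvgr_dist_lt /(_ _ eps0)[N _ /(_ N (leqnn N))] /=.
rewrite sub0r normrN => eN.
exists (occ (L N) (p N) C); exists N => // m /= Nm.
rewrite /ball /= distrC; apply: le_lt_trans (occ_dist dC Nm) _.
exact: le_lt_trans (ler_norm _) eN.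
Qed.

Definition limit_measure (mu : probability (Borel d) R) : Prop :=
  forall C, cylinder C -> (fun k => occ (L k) (p k) C) @ \oo --> pr mu C.

(** Nonnegativity and finite additivity of frequencies pass to the limit, and [cylinder_extension]
    does the rest. *)
Lemma limit_measure_exists : exists mu, limit_measure mu.
Proof.
pose m C := lim ((fun k => occ (L k) (p k) C) @ \oo).
have [|||mu muE] := @cylinder_extension d R m; last first.
- by exists mu => C cC; rewrite /pr muE//; exact: occ_cvg.
- move=> E F cE cF EF; rewrite /m -limD; [|exact: occ_cvg..].
  by congr (lim (_ @ \oo)); apply/funext => k; rewrite occU.
- rewrite /m (_ : (fun k => _) = cst 1) ?lim_cst//; apply/funext => k.
  rewrite /occ /dens -[RHS](avg_cst d (L k)); apply: eq_avg => t.
  by rewrite asboolT.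
- move=> C cC; rewrite /m; apply: limr_ge; first exact: occ_cvg.
  by apply: nearW => k; exact: occ_ge0.
Qed.

Section limit.
Variable mu : probability (Borel d) R.
Hypothesis mu_lim : limit_measure mu.

Lemma cvg_dist_le (u : nat -> R) (l a b : R) k : u @ \oo --> l ->
  (forall m, (k <= m)%N -> `|u m - a| <= b) -> `|l - a| <= b.
Proof.
move=> ul ub; have h : (fun m => `|u m - a|) @ \oo --> `|l - a|.
  by apply: cvg_norm; apply: cvgB => //; exact: cvg_cst.
by apply: cvgr_to_le h _; exists k.
Qed.

Lemma pr_occ_dist k C W : determined W C ->
  `|pr mu C - occ (L k) (p k) C| <= (size W)%:R * e k.
Proof.
move=> dC; apply: (@cvg_dist_le _ _ _ _ k (mu_lim _)); first by exists W.
by move=> m km; exact: occ_dist.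
Qed.

Lemma measurable_bshift v : measurable_fun setT (@bshift d v).
Proof.
apply: (@measurability _ _ (Borel d) (Borel d) _ _ [set A : set (Conf d) | open A]) => //.
move=> _ [U oU <-]; rewrite setTI; apply: open_measurable_Borel.
by apply: open_comp oU => x _; exact: shift_continuous.
Qed.

Lemma measurable_preimage_bshift v (A : set (Borel d)) :
  measurable A -> measurable (bshift v @^-1` A).
Proof. by move=> mA; rewrite -[X in measurable X]setTI; exact: measurable_bshift. Qed.

(** Frequencies over a full period are shift-invariant, and the cylinders are a pi-system generating
    the Borel sets. *)
Lemma limit_invariant : invariant_measure mu.
Proof.
move=> v A mA.
have mu2 := @measure_unique _ R (Borel d) (@cylinder d) (fun=> setT) _ _ _ _
  (pushforward mu (bshift v)) mu _ _ A mA.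
apply: (mu2 _ _ _ _ (measurable_bshift v)).
- exact: sigma_open_cylinder.
- by move=> B C; exact: cylinderI.
- by move=> _; rewrite -setC0; exact/cylinderC/cylinder0.
- by rewrite bigcup_const//; exists 0%N.
- move=> C cC.
  suff : mu (bshift v @^-1` C) = mu C by [].
  have mC := cylinder_measurable cC.
  rewrite !prE//; last exact: measurable_preimage_bshift.
  congr (_%:E); have := mu_lim (cylinder_shift v cC).
  rewrite (_ : (fun k => _) = (fun k => occ (L k) (p k) C)).
    by move=> h; exact: cvg_unique h (mu_lim cC).
  by apply/funext => k; rewrite occ_preimage_shift.
- move=> _; suff : (mu setT < +oo)%E by [].
  by rewrite probability_setT ltry.
Qed.

Lemma cvg_avg (M : nat) (F : nat -> Zd d -> R) (l : Zd d -> R) :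
  (forall t, F^~ t @ \oo --> l t) -> (fun k => avg M (F k)) @ \oo --> avg M l.
Proof.
move=> Fl; apply: cvgM; last exact: cvg_cst.
elim: (index_enum _) => [|v s IH].
  by rewrite big_nil; under eq_fun do rewrite big_nil; exact: cvg_cst.
by rewrite big_cons; under eq_fun do rewrite big_cons; exact: cvgD.
Qed.

(* The box average of [1_F] along the orbit of [p k] is exactly [occ (p k) F],
   since the box is a period; [p m] differs from [p k] on a set of small
   density. *)
Lemma avg_mixing k m E F W : determined W F -> (k <= m)%N ->
  `|avg (L k) (fun g => occ (L m) (p m) (E `&` Defs.shift g @^-1` F))
    - occ (L m) (p m) E * occ (L k) (p k) F| <= (size W)%:R * e k.
Proof.
move=> dF km.
pose I C (x : Conf d) t : R := (`[< C (Defs.shift t x) >])%:R.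
have IE g t : I (E `&` Defs.shift g @^-1` F) (p m) t = I E (p m) t * I F (p m) (g + t).
  by rewrite /I asbool_and -shiftD -natrM mulnb.
have -> : avg (L k) (fun g => occ (L m) (p m) (E `&` Defs.shift g @^-1` F)) =
    avg (L m) (fun t => I E (p m) t * avg (L k) (fun g => I F (p m) (g + t))).
  rewrite /occ /dens exchange_avg; apply: eq_avg => t.
  by rewrite -avgZ; apply: eq_avg => g; exact: IE.
have pF x M : lattice_periodic M (x : Zd d -> bool) -> lattice_periodic M (I F x).
  by move=> px t u; rewrite /I (periodic_occ F px).
have -> : occ (L m) (p m) E * occ (L k) (p k) F =
    avg (L m) (fun t => I E (p m) t * avg (L k) (fun g => I F (p k) (g + t))).
  rewrite mulrC /occ /dens -avgZ; apply: eq_avg => t; rewrite mulrC; congr (_ * _).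
  by rewrite avg_shift//; exact: pF.
rewrite -avgB; apply: le_trans (ler_norm_avg _ _) _.
apply: (@le_trans _ _ (avg (L m) (fun t => avg (L k) (fun g =>
    `|I F (p m) (g + t) - I F (p k) (g + t)|)))).
  apply: ler_avg => t; rewrite -mulrBr -avgB normrM.
  apply: le_trans (ler_norm_avg _ _); rewrite ler_piMl//.
  by rewrite /I; case: asboolP => _; rewrite ?normr1// normr0 ler01.
rewrite exchange_avg -[leRHS](avg_cst d (L k)); apply: ler_avg => g.
pose D t := `|I F (p m) t - I F (p k) t|.
rewrite (@eq_avg _ _ _ _ (fun t => D (t + g))); last by move=> t; rewrite /D [g + t]addrC.
rewrite avg_shift//; first exact: avg_indicator_dist.
by move=> t u; rewrite /D !pF//; exact: pLm.
Qed.

(** The bound of [avg_mixing] is uniform in [m], so [m] can tend to infinity with [k] fixed. *)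
Lemma pr_avg_mixing k E F W : cylinder E -> determined W F ->
  `|avg (L k) (fun g => pr mu (E `&` Defs.shift g @^-1` F))
    - pr mu E * occ (L k) (p k) F| <= (size W)%:R * e k.
Proof.
move=> cE dF.
pose u m := avg (L k) (fun g => occ (L m) (p m) (E `&` Defs.shift g @^-1` F))
  - occ (L m) (p m) E * occ (L k) (p k) F.
have ul : u @ \oo --> avg (L k) (fun g => pr mu (E `&` Defs.shift g @^-1` F))
    - pr mu E * occ (L k) (p k) F.
  apply: cvgB.
    apply: (@cvg_avg _ (fun m g => occ (L m) (p m) _)) => g; apply: mu_lim.
    by apply: cylinderI => //; apply: cylinder_shift; exists W.
  by apply: cvgM; [exact: mu_lim|exact: cvg_cst].
rewrite -[X in `|X|]subr0; apply: (@cvg_dist_le u _ _ _ k ul) => m km.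
by rewrite subr0; exact: avg_mixing.
Qed.

(** Let a cylinder [C] be close to the invariant set [A]. The average of the mass of [C] intersected
    with its translates over a period box is close to [mu A] by invariance, and to the square of
    [mu C] by [pr_avg_mixing]. Hence [mu A] equals its own square. *)
Lemma limit_ergodic : ergodic_measure mu.
Proof.
move=> A mA invA.
(* The constant collects [2 * eps] from the averages ([h1]), [2 * eps] from the squares ([h5]), and
   [eps / 2] each from [h2] and [h4]. *)
have bound (eps : R) : 0 < eps -> `|pr mu A - pr mu A * pr mu A| <= 5 * eps.
  move=> eps0; have [C cC lC] := cylinder_approx mu mA eps0.
  have mC := cylinder_measurable cC.
  have [W dC] := cC.
  have AC : `|pr mu A - pr mu C| < eps := le_lt_trans (pr_dist mu mA mC) lC.
  have ACg g : `|pr mu (C `&` Defs.shift g @^-1` C) - pr mu A| <= 2 * eps.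
    have mCg := measurable_preimage_bshift g mC.
    rewrite distrC; apply: le_trans (pr_dist mu mA (measurableI _ _ mC mCg)) _.
    have mS := measurable_symdiff mA mC.
    have mSg := measurable_preimage_bshift g mS.
    have le1 : pr mu (symdiff A (C `&` bshift g @^-1` C)) <=
        pr mu (symdiff A C `|` bshift g @^-1` symdiff A C).
      apply: le_pr; [|exact: measurableU|].
        by apply: measurable_symdiff => //; exact: measurableI.
      have iA x : A (bshift g x) <-> A x by rewrite -[in X in _ <-> X](invA g).
      move=> x [[Ax /not_andP[nC|nC]]|[[Cx Cgx] nA]].
      - by left; left.
      - by right; left; split => //; apply/iA.
      - by left; right.
    have := prU_le mu mS mSg.
    rewrite [pr mu (bshift g @^-1` _)]/pr limit_invariant// -/(pr mu _).
    move: le1; rewrite -/(@bshift d g); lra.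
  have : (fun k => (size W)%:R * e k) @ \oo --> (0 : R).
    by rewrite -(mulr0 (size W)%:R); apply: cvgM; [exact: cvg_cst|exact: (dist_cvg0 pLe)].
  have eps20 : 0 < eps / 2 by lra.
  move=> /cvgr_dist_lt /(_ _ eps20)[k _ /(_ k (leqnn k))] /=.
  rewrite sub0r normrN => /(le_lt_trans (ler_norm _)) ek.
  have h1 : `|avg (L k) (fun g => pr mu (C `&` Defs.shift g @^-1` C)) - pr mu A| <= 2 * eps.
    rewrite -[X in _ - X](avg_cst d (L k)) -avgB.
    apply: le_trans (ler_norm_avg _ _) _.
    by rewrite -[leRHS](avg_cst d (L k)); apply: ler_avg.
  have h2 := pr_avg_mixing k cC dC.
  have h3 := pr_occ_dist k dC.
  have A0 := pr_ge0 mu A; have A1 := pr_le1 mu mA.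
  have C0 := pr_ge0 mu C; have C1 := pr_le1 mu mC.
  have h4 : `|pr mu C * pr mu C - pr mu C * occ (L k) (p k) C| <= eps / 2.
    by rewrite -mulrBr normrM ger0_norm//; have := normr_ge0 (pr mu C - occ (L k) (p k) C); nra.
  have h5 : `|pr mu A * pr mu A - pr mu C * pr mu C| <= 2 * eps.
    rewrite -!expr2 subr_sqr normrM.
    rewrite [`|pr mu A + pr mu C|]ger0_norm ?addr_ge0//.
    apply: (@le_trans _ _ (eps * 2)); last by rewrite mulrC.
    apply: ler_pM; rewrite ?addr_ge0//; [exact: ltW|lra].
  move: h1 h2 h4 h5; rewrite !ler_norml => /andP[? ?] /andP[? ?] /andP[? ?] /andP[? ?].
  by apply/andP; split; lra.
have /eqP : pr mu A - pr mu A * pr mu A = 0.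
  apply/eqP; rewrite -normr_eq0 eq_le normr_ge0 andbT.
  apply/ler_addgt0Pr => eps eps0; rewrite add0r.
  have e50 : 0 < eps / 5 by lra.
  by have := bound _ e50; lra.
rewrite -[X in X - _]mulr1 -mulrBr mulf_eq0 subr_eq0 => /orP[/eqP|/eqP/esym] h;
  [left|right]; by rewrite prE// h.
Qed.

(** The complement of [X] is a countable union of cylinders that no orbit visits, so each of them is
    null in the limit. *)
Lemma limit_supported (X : set (Conf d)) :
  closed X -> (forall k t, X (Defs.shift t (p k))) -> supported_on mu X.
Proof.
move=> cX Xp; have mX : measurable (X : set (Borel d)).
  exact: closed_measurable_Borel.
have [F cF XF] := open_bigcup_cylinder (closed_openC cX).
have F0 n : mu (F n) = 0%E.
  rewrite prE; last exact: cylinder_measurable.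
  have := mu_lim (cF n); rewrite (_ : (fun k => _) = cst 0).
    by move=> h; congr (_%:E); exact: cvg_unique h (cvg_cst _).
  apply/funext => k; rewrite /occ /dens -[RHS](avg_cst d (L k)).
  apply: eq_avg => t; rewrite asboolF// => Ft.
  suff : (~` X) (Defs.shift t (p k)) by apply; exact: Xp.
  by rewrite XF; exists n.
have nX : mu (~` X) = 0%E.
  have : (mu (~` X) <= \sum_(n <oo) mu (F n))%E.
    rewrite XF; apply: measure_sigma_subadditive => //.
      by move=> n; exact: cylinder_measurable.
    by apply: bigcupT_measurable => n; exact: cylinder_measurable.
  rewrite eseries0; last by move=> n _ _; exact: F0.
  by move=> nX; apply/eqP; rewrite eq_le measure_ge0 andbT.
by rewrite /supported_on -[X]setCK probability_setC ?nX ?sube0//; exact: measurableC.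
Qed.

(** For [g != 0] the [g]-fixed points form an invariant set, whose mass is not 1 since [z 0 != z g]
    has positive mass; by ergodicity it is null. An atom would thus have infinitely many distinct
    translates of equal mass. *)
Lemma limit_nonatomic : (0 < d)%N ->
  (forall g : Zd d, g != 0 -> exists k,
     2 * e k < dens R (L k) (fun t => p k t != p k (t + g))) ->
  nonatomic_measure mu.
Proof.
move=> d0 aper x; have mx y : measurable ([set y] : set (Borel d)).
  apply: closed_measurable_Borel.
  have -> : [set y] = \bigcap_u [set z : Conf d | z u = y u].
    apply/seteqP; split=> [z -> //|z zy]; apply/funext => u; exact: zy.
  apply: closed_bigI => u _; apply: cylinder_closed; exists [:: u] => z w zw.
  by rewrite /= -zw ?inE.
have fixed g : g != 0 -> Defs.shift g x = x -> mu [set x] = 0%E.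
  move=> /aper[k ek] gx.
  pose P := [set y : Borel d | bshift g y = y].
  have cP : closed (P : set (Conf d)).
    have -> : P = \bigcap_u [set z : Conf d | z (u + g) = z u].
      apply/seteqP; split=> [z zP u _ /=|z zy]; last by apply/funext => u; exact: zy.
      by have /(congr1 (@^~ u)) := zP.
    apply: closed_bigI => u _; apply: cylinder_closed.
    exists [:: u + g; u] => z w zw; rewrite /= !zw ?inE ?eqxx ?orbT//.
  have mP := closed_measurable_Borel cP.
  pose D := [set z : Conf d | z 0 != z g].
  have dD : determined [:: 0; g] D.
    by move=> z w zw; rewrite /D /= !zw ?inE ?eqxx ?orbT.
  have mD : measurable (D : set (Borel d)) by apply: cylinder_measurable; exists [:: 0; g].
  have occD : occ (L k) (p k) D = dens R (L k) (fun t => p k t != p k (t + g)).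
    apply: eq_avg => t; rewrite /D /Defs.shift /= add0r asboolb.
    by rewrite [g + t]addrC.
  (* The factor 2 in [aper] is the size of the window [[:: 0; g]]. *)
  have D0 : 0 < pr mu D.
    have := pr_occ_dist k dD; rewrite occD /= ler_norml => /andP[]; lra.
  have [P0|P1] : mu P = 0%E \/ mu P = 1%E.
  - apply: limit_ergodic => // v; apply/seteqP; split=> z; rewrite /P /preimage /=.
      rewrite /bshift shiftD addrC -shiftD.
      exact: (can_inj (shiftK v)).
    by rewrite /bshift shiftD addrC -shiftD => ->.
  - apply/eqP; rewrite eq_le measure_ge0 andbT -P0.
    by apply: le_measure; rewrite ?inE// => _ ->.
  - have nP : mu (~` P) = 0%E by rewrite probability_setC// P1 subee.
    have : pr mu D <= pr mu (~` P).
      apply: le_pr => //; first exact: measurableC.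
      move=> z /eqP zD /(congr1 (@^~ 0)); rewrite /bshift /Defs.shift add0r.
      by move=> /esym.
    by rewrite {2}/pr nP /= leNgt D0.
have [//|x0] := pselect (mu [set x] = 0%E); exfalso.
pose i0 := Ordinal d0; pose y (n : nat) : Conf d := Defs.shift ((delta_mx 0 i0 : Zd d) *+ n) x.
have delta_neq0 n : (delta_mx 0 i0 : Zd d) *+ n.+1 != 0.
  apply/eqP => /rowP/(_ i0); rewrite mulmxnE !mxE !eqxx /= => /eqP.
  by rewrite pnatr_eq0.
have yE n : mu [set y n] = mu [set x].
  rewrite -(limit_invariant ((delta_mx 0 i0 : Zd d) *+ n) (mx (y n))); congr (mu _).
  apply/seteqP; split=> z /=; last by move=> ->.
  exact: (can_inj (shiftK ((delta_mx 0 i0 : Zd d) *+ n))).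
have y_neq m n : (m < n)%N -> y m <> y n.
  move=> mn ymn; apply: x0; apply: (fixed ((delta_mx 0 i0 : Zd d) *+ (n - m))).
    by rewrite -(prednK (n := n - m)) ?subn_gt0.
  apply: (can_inj (shiftK ((delta_mx 0 i0 : Zd d) *+ m))).
  by rewrite shiftD -mulrnDr subnKC ?(ltnW mn).
have sumy n : pr mu (\big[setU/set0]_(i < n) [set y i]) = pr mu [set x] *+ n.
  elim: n => [|n IH]; first by rewrite big_ord0 /pr measure0.
  rewrite big_ord_recr /= prU//.
  - by rewrite mulrSr IH {2}/pr yE.
  - by apply: bigsetU_measurable.
  - apply/seteqP; split => // z [+ zy]; rewrite zy -(bigcup_mkord n (fun i => [set y i])).
    by move=> [m /= mn /esym]; exact: y_neq.
have c0 : 0 < pr mu [set x].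
  by rewrite lt_neqAle pr_ge0 andbT eq_sym; apply/eqP => h; apply: x0; rewrite prE// h.
(* More than [1 / pr mu [set x]] distinct translates would have total mass above 1. *)
have := archi_boundP (ltW (divr_gt0 ltr01 c0)).
rewrite ltr_pdivrMr// mulr_natl ltNge -sumy.
by rewrite pr_le1//; exact: bigsetU_measurable.
Qed.

End limit.

End besicovitch_limits.

(** * The hierarchical periodic configurations *)

Section construction.
Variable d : nat.
Implicit Types (t s u v g : Zd d.+1) (i : 'I_d.+1) (n m k N : nat).

(* The factor [side n ^ d.+1] makes the exceptional density [n.+1 / branch n]
   small against the least positive density of a [side n]-periodic set. *)
Definition branching n (L : nat) := (n.+1 * L ^ d.+1 * 2 ^ n.+4)%N.

Fixpoint side n := if n is m.+1 then (side m * branching m (side m))%N else 1%N.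

Definition branch n := branching n (side n).

Lemma sideS n : side n.+1 = (side n * branch n)%N. Proof. by []. Qed.

Lemma side_gt0 n : (0 < side n)%N.
Proof.
elim: n => // n IH.
have h1 : (0 < 2 ^ n.+4)%N by rewrite expn_gt0.
have h2 : (0 < side n ^ d.+1)%N by rewrite expn_gt0 IH.
by rewrite sideS muln_gt0 IH muln_gt0 muln_gt0 h2 h1.
Qed.

Lemma branch_gt n : (n.*2.+3 < branch n)%N.
Proof.
apply: (@leq_trans (n.+1 * 16)%N); first by lia.
rewrite /branch /branching -mulnA leq_pmul2l//.
apply: (@leq_trans (2 ^ n.+4)%N); first exact: (@leq_pexp2l 2 4 n.+4).
by rewrite leq_pmull// expn_gt0 side_gt0.
Qed.

Lemma side_gt n : (n < side n)%N.
Proof.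
elim: n => // n IH; rewrite sideS; have := branch_gt n; have := side_gt0 n.
by nia.
Qed.

Lemma side_dvd k m : (k <= m)%N -> (side k %| side m)%N.
Proof.
move=> /subnKC <-; elim: (m - k)%N => [|j IH]; first by rewrite addn0.
by rewrite addnS sideS dvdn_mulr.
Qed.

Lemma side_branch_dvd n m : (n < m)%N -> (side n * branch n %| side m)%N.
Proof. by rewrite -sideS; exact: side_dvd. Qed.

Lemma leq_side k m : (k <= m)%N -> (side k <= side m)%N.
Proof. by move=> /side_dvd; apply: dvdn_leq; exact: side_gt0. Qed.

Definition cell n t i : int := (t ord0 i %/ side n)%Z.

(** Coordinate [i] of the position of the level-[n] cell of [t] inside the enclosing cell of level
    [n.+1]. *)
Definition pos n t i : int := (cell n t i %% branch n)%Z.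

(* [conf n.+1] coincides with [conf (child n t)] on the cell of side [side n]
   around [t]; the exceptional cells sit at positions [(2j+1, ..., 2j+1)]. *)
Definition child n t : nat :=
  let q := `|pos n t ord0|%N in
  if [&& odd q, (q./2 <= n)%N & [forall i, pos n t i == q]] then q./2 else n.-1.

Definition descend N t n := if (n <= N)%N then n else child n.-1 t.

(** The index of the configuration that the level-[N] tiling of [conf n] shows at [t]. Each descent
    above [N] strictly lowers the index, so [n] rounds are enough fuel. *)
Definition idx N n t := iter n (descend N t) n.

Definition conf n : Conf d.+1 := fun t => idx 1 n t == 1%N.

Lemma pos_ge0 n t i : 0 <= pos n t i.
Proof. by rewrite modz_ge0//; have := branch_gt n; lia. Qed.

Lemma pos_lt n t i : pos n t i < branch n.
Proof. by rewrite ltz_pmod//; have := branch_gt n; lia. Qed.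

Variant child_spec n t : nat -> Type :=
| ChildSpecial j of (j <= n)%N & (forall i, pos n t i = j.*2.+1) :
    child_spec n t j
| ChildMain of (forall j, (j <= n)%N -> exists i, pos n t i != j.*2.+1) :
    child_spec n t n.-1.

Lemma childP n t : child_spec n t (child n t).
Proof.
rewrite /child; set q := `|pos n t ord0|%N.
case: ifP => [/and3P[oq qn /forallP qE]|nq].
  apply: ChildSpecial => // i.
  by rewrite (eqP (qE i)) -[in LHS](odd_double_half q) oq.
apply: ChildMain => j jn; apply/existsP; apply: contraFT nq.
rewrite negb_exists => /forallP nE.
have E i : pos n t i = j.*2.+1 by apply/eqP; rewrite -[_ == _]negbK.
have qE : q = j.*2.+1 by rewrite /q E.
rewrite qE /= uphalf_double jn odd_double /=.
by apply/forallP => i; rewrite E.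
Qed.

Lemma child_le n t : (child n t <= n)%N.
Proof. by case: childP => // _; exact: leq_pred. Qed.

Lemma child_special n t j : (j <= n)%N -> (forall i, pos n t i = j.*2.+1) ->
  child n t = j.
Proof.
move=> jn E; case: childP => [k kn /(_ 0)|/(_ _ jn)[i]]; rewrite E ?eqxx//.
by move=> []; lia.
Qed.

(** Exceptional positions are odd and at most [n.*2.+1], which [branch_gt] keeps below the last
    position. *)
Lemma child_boundary n t i : pos n t i = 0 \/ pos n t i = (branch n)%:Z - 1 ->
  child n t = n.-1.
Proof.
move=> E; case: childP => // j jn /(_ i) pE; have := branch_gt n.
by case: E; rewrite pE; lia.
Qed.

Lemma eq_child n t s : pos n t =1 pos n s -> child n t = child n s.
Proof.
move=> E; rewrite /child E.
by under eq_forallb do rewrite E.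
Qed.

Lemma idx_small N n t : (n <= N)%N -> idx N n t = n.
Proof.
by rewrite /idx => nN; elim: {1}n => //= k ->; rewrite /descend nN.
Qed.

Lemma iter_descend N n k t : (n <= k)%N -> iter k (descend N t) n = idx N n t.
Proof.
rewrite /idx; elim/ltn_ind: n k => n IH k nk.
have [nN|Nn] := leqP n N.
  have h j : iter j (descend N t) n = n.
    by elim: j => //= j ->; rewrite /descend nN.
  by rewrite !h.
case: n => // n in IH k nk Nn *; case: k => // k in nk *.
rewrite !iterSr {2 4}/descend leqNgt Nn /=.
have cn := child_le n t.
by rewrite (IH (child n t))// ?(IH (child n t) _ n)//; lia.
Qed.

Lemma idx_step N n t : (N <= n)%N -> idx N n.+1 t = idx N (child n t) t.
Proof.
move=> Nn; rewrite {1}/idx iterSr {2}/descend leqNgt ltnS Nn /=.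
exact/iter_descend/child_le.
Qed.

Lemma idx_le N n t : (idx N n t <= N)%N.
Proof.
elim/ltn_ind: n => n IH; have [nN|Nn] := leqP n N; first by rewrite idx_small.
by case: n => // n in IH Nn *; rewrite idx_step// IH// ltnS child_le.
Qed.

Lemma conf_step n t : (0 < n)%N -> conf n.+1 t = conf (child n t) t.
Proof. by move=> n0; rewrite /conf idx_step. Qed.

Lemma conf_idx N n t : (0 < N)%N -> conf n t = conf (idx N n t) t.
Proof.
move=> N0; elim/ltn_ind: n => n IH.
have [nN|Nn] := leqP n N; first by rewrite idx_small.
case: n => // n in IH Nn *.
rewrite (@conf_step n t) ?(@idx_step N n t)//; last by lia.
by apply: IH; rewrite ltnS child_le.
Qed.

Lemma conf0 t : conf 0 t = false. Proof. by []. Qed.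
Lemma conf1 t : conf 1 t = true. Proof. by []. Qed.

Lemma cell_coarsen k m t s : (k <= m)%N -> cell k t =1 cell k s ->
  cell m t =1 cell m s.
Proof.
move=> /side_dvd/dvdnP[c cE] E i; rewrite /cell cE mulnC PoszM.
by rewrite !divzMA_ge0// -!/(cell k _ i) E.
Qed.

Lemma child_cell N n t s : (N <= n)%N -> cell N t =1 cell N s ->
  child n t = child n s.
Proof.
by move=> Nn /(cell_coarsen Nn) E; apply: eq_child => i; rewrite /pos E.
Qed.

(** Every child consulted has level at least [N] and depends only on cells of that level, which are
    unions of level-[N] cells. *)
Lemma idx_cell N n t s : cell N t =1 cell N s -> idx N n t = idx N n s.
Proof.
move=> E; elim/ltn_ind: n => n IH.
have [nN|Nn] := leqP n N; first by rewrite !idx_small.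
case: n => // n in IH Nn *.
by rewrite !idx_step// (child_cell (N := N) _ E)// IH// ltnS child_le.
Qed.

Lemma pos_periodic n m t u : (n < m)%N -> pos n (t + u *+ side m) =1 pos n t.
Proof.
move=> /side_branch_dvd/dvdnP[c cE] i.
rewrite /pos /cell !mxE mulmxnE cE -mulr_natr natz.
have -> : u ord0 i * (c * (side n * branch n))%N%:Z =
    (u ord0 i * c%:Z * (branch n)%:Z) * (side n)%:Z by rewrite !PoszM; ring.
rewrite divzDr ?dvdz_mull// mulzK; last by have := side_gt0 n; lia.
by rewrite -modzDmr modzMl addr0.
Qed.

Lemma conf_periodic n : lattice_periodic (side n) (conf n : Zd d.+1 -> bool).
Proof.
elim/ltn_ind: n => n IH t u; case: n => [|[|n]] // in IH *.
rewrite !conf_step// (eq_child (s := t)); last exact: pos_periodic.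
have cn := child_le n.+1 t.
by apply: (periodic_dvd _ (IH _ _)) => //; apply: side_dvd; lia.
Qed.

End construction.

(** * Cell boundaries and neighbouring cells *)

Section geometry.
Variable d : nat.
Implicit Types (t s u v g : Zd d.+1) (i : 'I_d.+1) (n m k N : nat).

(** In direction [i], [t] lies in the first or the last layer of its cell of side [M]. *)
Definition on_boundary (M : nat) t i :=
  (M %| t ord0 i)%Z \/ (M %| t ord0 i + 1)%Z.

(** A face of a cell of side [side d m] is also a face of a cell of side [side d n.+1], so the
    level-[n] subcell touching it comes first or last. *)
Lemma on_boundary_pos n m t i : (n < m)%N -> on_boundary (side d m) t i ->
  pos n t i = 0 \/ pos n t i = (branch d n)%:Z - 1.
Proof.
move=> nm; have sn := side_gt0 d n; have bn := branch_gt d n.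
have /dvdnP[c cE] := side_branch_dvd d nm.
rewrite /on_boundary /pos /cell cE; case=> /dvdzP[q].
  move=> ->; left.
  have -> : q * (c * (side d n * branch d n))%N%:Z =
    (q * c%:Z * (branch d n)%:Z) * (side d n)%:Z by rewrite !PoszM; ring.
  by rewrite mulzK ?modzMl//; lia.
move=> /(canRL (addrK 1)) ->; right.
have -> : q * (c * (side d n * branch d n))%N%:Z - 1 =
    (q * c%:Z * (branch d n)%:Z - 1) * (side d n)%:Z + ((side d n)%:Z - 1).
  by rewrite !PoszM; ring.
rewrite divzMDl; last by lia.
rewrite [X in _ + X]divz_small ?addr0; last by rewrite gez0_abs; lia.
have -> : q * c%:Z * (branch d n)%:Z - 1 =
  (q * c%:Z - 1) * (branch d n)%:Z + ((branch d n)%:Z - 1) by ring.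
by rewrite modzMDl modz_small//; lia.
Qed.

(** On the boundary no subcell is exceptional, so each descent goes from [n.+1] to [n.-1] and cannot
    jump over both [N] and [N.-1]. *)
Lemma idx_boundary N n m t i : (n <= m)%N -> (N.-1 <= n)%N ->
  on_boundary (side d m) t i -> (N.-1 <= idx N n t)%N.
Proof.
move=> + + bt; elim/ltn_ind: n => n IH nm Nn'.
have [nN|Nn] := leqP n N; first by rewrite idx_small.
case: n => // n in IH nm Nn Nn' *; rewrite idx_step//.
rewrite (child_boundary (on_boundary_pos _ bt))//.
by apply: IH; lia.
Qed.

Definition unit_vec i : Zd d.+1 := delta_mx ord0 i.

(** Descend until the children of the two neighbours differ. A face between level-[n] cells then
    separates them, one of these cells is not exceptional, and [idx_boundary] applies to the
    neighbour lying in it. *)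
Lemma idx_adjacent N n t i : (0 < N)%N ->
  [\/ idx N n t = idx N n (t + unit_vec i), (N.-1 <= idx N n t)%N |
      (N.-1 <= idx N n (t + unit_vec i)%R)%N].
Proof.
move=> N0; set s := t + unit_vec i.
have sE j : s ord0 j = t ord0 j + (j == i)%:Z by rewrite !mxE /= eq_sym; case: eqVneq.
elim/ltn_ind: n => n IH; have [nN|Nn] := leqP n N.
  by apply: Or31; rewrite !idx_small.
case: n => // n in IH Nn *; rewrite !idx_step//.
have [cc|cc] := eqVneq (child n t) (child n s).
  by rewrite -cc; apply: IH; rewrite ltnS child_le.
have sn := side_gt0 d n; have bn := branch_gt d n.
(* Different children force different positions, so the unit step enters a new level-[n] cell. *)
have crossing : ((side d n)%:Z %| s ord0 i)%Z.
  apply: contraNT cc => ndv; apply/eqP/eq_child => j.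
  rewrite /pos /cell sE; case: eqVneq => [->|_]; last by rewrite addr0.
  congr (_ %% _)%Z; move: ndv; rewrite sE eqxx.
  move: (t ord0 i) => x; have xE := divz_eq x (side d n).
  have r0 := modz_ge0 x (d := side d n); have r1 := ltz_pmod x (d := side d n).
  move: (x %/ side d n)%Z (x %% side d n)%Z xE r0 r1 => q r -> r0 r1 ndv.
  have rS : r + 1 <> (side d n)%:Z.
    by move=> rE; move: ndv; rewrite -addrA rE -[X in _ + X]mul1r -mulrDl dvdz_mull.
  rewrite -addrA !divzMDl; [|lia..].
  by rewrite divz_small ?addr0//=; lia.
have bs : on_boundary (side d n) s i by left.
have bt : on_boundary (side d n) t i by right; rewrite -[1]/((true)%:Z) -(eqxx i) -sE.
have n0 : (0 < n)%N by lia.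
case: (childP n t) cc => [j jn jE|_] cc; last first.
  by apply: Or32; apply: (@idx_boundary N _ n _ i) => //; lia.
case: (childP n s) cc => [k kn kE|_] cc; last first.
  by apply: Or33; apply: (@idx_boundary N _ n _ i) => //; lia.
(* Two exceptional cells would have odd positions in direction [i], yet that of [t] is one less than
   the nonzero position of its neighbour. *)
exfalso; have := jE i; have := kE i.
rewrite /pos /cell sE eqxx; move: crossing; rewrite sE eqxx.
move=> /dvdzP[q qE]; have tE : t ord0 i = (q - 1) * (side d n)%:Z + ((side d n)%:Z - 1).
  by rewrite mulrBl -qE mul1r /=; lia.
rewrite qE mulzK; last by lia.
rewrite tE divzMDl; last by lia.
rewrite [X in (_ + X)]divz_small ?addr0; last by rewrite gez0_abs; lia.
move: (branch d n) bn => b bn qk.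
rewrite (divz_eq q b) qk -addrA modzMDl modz_small; [lia|].
by apply/andP; split; lia.
Qed.

End geometry.

(** * Recurrence of patterns and aperiodicity *)

Section patterns.
Variable d : nat.
Implicit Types (t s u v g : Zd d.+1) (i : 'I_d.+1) (n m k N : nat).

(** Unit steps toward [t0] stay in the box, and along them [idx_adjacent] forbids a change while the
    index is below [N.-1]. *)
Lemma idx_connected N n K t0 : (0 < N)%N ->
  (forall s, (forall i, `|s ord0 i - t0 ord0 i|%N <= K)%N -> (idx N n s < N.-1)%N) ->
  forall t, (forall i, `|t ord0 i - t0 ord0 i|%N <= K)%N -> idx N n t = idx N n t0.
Proof.
move=> N0 small t.
have [D] := ubnP (\sum_i `|t ord0 i - t0 ord0 i|%N)%N.
elim: D t => // D IH t; rewrite ltnS => tD tK.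
have [->//|tt0] := eqVneq t t0.
have [i ti] : exists i, t ord0 i != t0 ord0 i.
  apply/existsP; apply: contraNT tt0; rewrite negb_exists => /forallP tE.
  by apply/eqP/rowP => i; apply/eqP/negPn.
have closer s : (forall j, j != i -> s ord0 j = t ord0 j) ->
    (`|s ord0 i - t0 ord0 i|.+1 = `|t ord0 i - t0 ord0 i|)%N ->
    idx N n s = idx N n t0 /\ (idx N n s < N.-1)%N.
  move=> sE si; have sK j : (`|s ord0 j - t0 ord0 j|%N <= K)%N.
    have [->|ji] := eqVneq j i; first by have := tK i; lia.
    by rewrite sE.
  split; last exact: small.
  apply: IH => //; apply: leq_trans tD.
  rewrite (bigD1 i)//= [ltnRHS](bigD1 i)//= -si addSn ltnS leq_add2l.
  by apply: leq_sum => j ji; rewrite sE.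
have tN := small t tK.
have [lt|gt] : t ord0 i < t0 ord0 i \/ t0 ord0 i < t ord0 i by lia.
- have [j ji||<- sN] := closer (t + unit_vec i).
  + by rewrite !mxE (negbTE ji) andbF addr0.
  + by rewrite !mxE !eqxx /=; lia.
  by case: (idx_adjacent n t i N0) => //; lia.
- have [j ji||<- sN] := closer (t - unit_vec i).
  + by rewrite !mxE (negbTE ji) andbF subr0.
  + by rewrite !mxE !eqxx /=; lia.
  by have := idx_adjacent n (t - unit_vec i) i N0; rewrite subrK => -[->|h|h] //; lia.
Qed.

Lemma bounded_window (W : seq (Zd d.+1)) :
  exists rho : nat, forall u i, u \in W -> (`|u ord0 i|%N <= rho)%N.
Proof.
exists (\max_(u <- W) \max_i `|u ord0 i|%N)%N => u i uW.
by apply: leq_trans (leq_bigmax_seq u uW _) => //; exact: leq_bigmax.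
Qed.

Lemma conf_congr n t s : (forall i, (side d n %| t ord0 i - s ord0 i)%Z) ->
  conf n t = conf n s.
Proof.
move=> dv; rewrite -(conf_periodic n s (\row_i ((t ord0 i - s ord0 i) %/ side d n)%Z)).
congr (conf n _); apply/rowP => i.
by rewrite !mxE mulmxnE !mxE -mulr_natr natz divzK ?dv// addrC subrK.
Qed.

(** Each cell of side [side d n.+1] in [conf n.+1] has an exceptional subcell filled with [conf m],
    wide enough for the window once [n] is large; periodicity of [conf m] lets the window be placed
    in phase with [t]. *)
Lemma pattern_occurs (W : seq (Zd d.+1)) m t : exists M, forall j, (M <= j)%N ->
  forall a, exists v, forall u, u \in W ->
    cell j (v + u) =1 cell j a /\ conf j (v + u) = conf m (t + u).
Proof.
have [rho rhoW] := bounded_window W; pose S := side d m.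
(* Since [n < side d n], the first three terms leave room for the offset [x] and the window; the
   term [m] ensures [m <= n]. *)
exists (S * rho + S + rho + m).+2 => j; case: j => // n Mn a.
have S0 : (0 < S)%N by exact: side_gt0.
have sn := side_gt d n; have bn := branch_gt d n.
(* An offset of at least [rho], so the window stays in the subcell, and congruent to [t] modulo
   [S]. *)
pose x i := (S * rho)%N%:Z + (t ord0 i %% S)%Z.
pose v : Zd d.+1 := \row_i (cell n.+1 a i * (side d n.+1)%:Z + (m.*2.+1 * side d n)%N%:Z + x i).
exists v => u uW.
have xu i : 0 <= x i + u ord0 i < side d n.
  have := rhoW u i uW; rewrite /x.
  have r0 := modz_ge0 (t ord0 i) (d := S); have r1 := ltz_pmod (t ord0 i) (d := S).
  have : (rho <= S * rho)%N by rewrite leq_pmull.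
  by move: (S * rho)%N (t ord0 i %% S)%Z r0 r1 Mn => P r r0 r1 Mn; lia.
have vuE i : (v + u) ord0 i = (cell n.+1 a i * (branch d n)%:Z + m.*2.+1%:Z) * (side d n)%:Z
    + (x i + u ord0 i).
  by rewrite !mxE sideS !PoszM; ring.
have qE i : cell n (v + u) i = cell n.+1 a i * (branch d n)%:Z + m.*2.+1%:Z.
  rewrite /cell vuE divzMDl; last by lia.
  by rewrite divz_small ?addr0 ?gez0_abs//.
have mb : (m.*2.+1 < branch d n)%N by lia.
split.
  move=> i; rewrite {1}/cell sideS PoszM divzMA_ge0// -/(cell n _ i) qE.
  rewrite divzMDl; last by lia.
  by rewrite divz_small ?addr0//.
rewrite conf_step; last by lia.
rewrite (@child_special _ n (v + u) m); [|lia|]; last first.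
  by move=> i; rewrite /pos qE modzMDl modz_small.
apply: conf_congr => i; rewrite !mxE -/S.
have -> : cell n.+1 a i * side d n.+1 + (m.*2.+1 * side d n)%N + x i + u ord0 i - (t ord0 i + u ord0 i)
  = cell n.+1 a i * side d n.+1 + (m.*2.+1 * side d n)%N + (S * rho)%N%:Z
    - (t ord0 i - (t ord0 i %% S)%Z) by rewrite /x; ring.
have sm : (S %| side d n)%N by apply: side_dvd; lia.
have h1 : (S%:Z %| cell n.+1 a i * side d n.+1)%Z.
  by apply: dvdz_mull; rewrite dvdzE !absz_nat sideS dvdn_mulr.
have h2 : (S%:Z %| (m.*2.+1 * side d n)%N%:Z)%Z by rewrite dvdzE !absz_nat dvdn_mull.
have h3 : (S%:Z %| (S * rho)%N%:Z)%Z by rewrite dvdzE !absz_nat dvdn_mulr.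
have h4 : (S%:Z %| t ord0 i - (t ord0 i %% S)%Z)%Z.
  by rewrite {1}(divz_eq (t ord0 i) S) addrK dvdz_mull.
by rewrite rpredB// rpredD// rpredD.
Qed.

Lemma invariant_mulrz (T : Type) (f : Zd d.+1 -> T) g (z : int) :
  (forall t, f (t + g) = f t) -> forall t, f (t + g *~ z) = f t.
Proof.
move=> fg.
have fn n : forall t, f (t + g *+ n) = f t.
  by elim: n => [|n IH] t; [rewrite addr0|rewrite mulrS addrA IH].
case: z => n t; first exact: fn.
by have := fn n.+1 (t - g *+ n.+1); rewrite subrK NegzE mulrNz => ->.
Qed.

(* The two configurations differ somewhere, and their difference set avoids a
   slab of thickness [side k.+1] that every nonzero translation orbit meets. *)
Lemma conf_aperiodic g k i : g ord0 i != 0 -> (`|g ord0 i|%N <= side d k.+1)%N ->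
  ~ ((forall t, conf k (t + g) = conf k t) /\
     (forall t, conf k.+2 (t + g) = conf k.+2 t)).
Proof.
move=> gi gle [/invariant_mulrz Pk /invariant_mulrz Pk2].
(* The corners of the exceptional cells filled with the constants [conf 0] and [conf 1]; [conf k]
   takes the same value at both, so it is wrong at one of them. *)
pose c (j : nat) : Zd d.+1 := \row_i (j.*2.+1 * side d k.+1)%N%:Z.
have bk := branch_gt d k.+1; have sk := side_gt0 d k.+1.
have cj j : (j <= 1)%N -> conf k.+2 (c j) = conf j (c j).
  move=> j1; rewrite conf_step//; congr (conf _ _); apply: child_special; first by lia.
  move=> i'; rewrite /pos /cell mxE PoszM mulzK; last by lia.
  by rewrite modz_small//; lia.
have ck j : conf k (c j) = conf k (0 : Zd d.+1).
  apply: conf_congr => i'; rewrite !mxE subr0 dvdzE !absz_nat.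
  by rewrite dvdn_mull// side_dvd.
have [t diff] : exists t, conf k.+2 t <> conf k t.
  case E : (conf k (0 : Zd d.+1)); [exists (c 0%N)|exists (c 1%N)]; by rewrite cj// ck E.
(* Translating by [g *~ z] reduces coordinate [i] modulo that of [g], hence into the slab between 0
   and [side d k.+1]. *)
apply: diff; pose z := - (t ord0 i %/ g ord0 i)%Z.
rewrite -(Pk z t) -(Pk2 z t) conf_step//.
congr (conf _ _); apply: (child_boundary (i := i)); left.
rewrite /pos /cell.
have -> : (t + g *~ z) ord0 i = (t ord0 i %% g ord0 i)%Z.
  have mz w (y : int) : (w *~ y : Zd d.+1) ord0 i = w ord0 i * y.
    by rewrite -scaler_int mxE mulrC intz.
  by rewrite mxE mz /z /modz; ring.
have r0 := modz_ge0 (t ord0 i) gi; have r1 := ltz_mod (t ord0 i) gi.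
by rewrite divz_small ?mod0z//; lia.
Qed.

End patterns.

(** * Density of the exceptional cells and Besicovitch convergence *)

Section densities.
Variables (R : realType) (d : nat).
Implicit Types (t s u v g : Zd d.+1) (n m k : nat).

(** Translation by [side d n] along the first axis permutes the positions cyclically, so the
    [branch d n] classes share the total density 1 equally. *)
Lemma dens_pos n (q : nat) : (q < branch d n)%N ->
  dens R (side d n.+1) (fun t => pos n t ord0 == q) = (branch d n)%:R^-1.
Proof.
have bn := branch_gt d n; have sn := side_gt0 d n.
have S0 := side_gt0 d n.+1.
pose P (q : nat) t := pos n t ord0 == q.
have pP r : lattice_periodic (side d n.+1) (P r).
  by move=> t u; rewrite /P pos_periodic.
have PE (r : nat) : (r < branch d n)%N ->
    dens R (side d n.+1) (P r) = dens R (side d n.+1) (P 0%N).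
  move=> rb; rewrite -(dens_shift R (unit_vec ord0 *+ (side d n * r)) S0 (pP r)).
  apply: eq_avg => t; congr (nat_of_bool _)%:R; rewrite /P /pos /cell.
  have -> : (t + unit_vec ord0 *+ (side d n * r)) ord0 ord0 =
      r%:Z * (side d n)%:Z + t ord0 ord0.
    by rewrite !mxE mulmxnE !mxE !eqxx /= mulr1n natz PoszM; ring.
  rewrite divzMDl; last by lia.
  rewrite addrC.
  move: (_ %/ _)%Z => x; rewrite -modzDml.
  have x0 := modz_ge0 x (d := branch d n); have x1 := ltz_pmod x (d := branch d n).
  move: (x %% branch d n)%Z x0 x1 => y y0 y1.
  have [lt|ge] := ltP (y + r) (branch d n).
    by rewrite modz_small//; lia.
  rewrite -[y + r](subrK (branch d n)%:Z) modzDr modz_small//; lia.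
move=> qb; rewrite -/(P q) PE//.
have : \sum_(r < branch d n) dens R (side d n.+1) (P r) = 1.
  rewrite -avg_sum -[RHS](avg_cst d.+1 (side d n.+1)); apply: eq_avg => t.
  have lt : (`|pos n t ord0| < branch d n)%N.
    by have := pos_lt n t ord0; have := pos_ge0 n t ord0; lia.
  rewrite (bigD1 (Ordinal lt))//= big1 ?addr0 => [|r rn].
    by rewrite /P /= gez0_abs ?eqxx// pos_ge0.
  rewrite /P; case: eqP => // rE; case/eqP: rn; apply/val_inj => /=.
  by rewrite rE.
under eq_bigr do rewrite PE//.
rewrite sumr_const card_ord => h.
have b0 : (branch d n)%:R != 0 :> R by rewrite pnatr_eq0; lia.
by apply: (mulIf b0); rewrite mulr_natr h mulVf.
Qed.

(** Exceptional cells are counted through their first coordinate alone, a crude bound that the size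
    of [branch] absorbs. *)
Lemma dens_conf_neq n : (0 < n)%N ->
  dens R (side d n.+1) (fun t => conf n.+1 t != conf n.-1 t) <=
  n.+1%:R / (branch d n)%:R.
Proof.
move=> n0; apply: (@le_trans _ _ (dens R (side d n.+1)
    (fun t => has (fun j => pos n t ord0 == j.*2.+1) (iota 0 n.+1)))).
  apply: le_dens => t; rewrite conf_step//; case: childP => [j jn E _|].
    by apply/hasP; exists j; rewrite ?mem_iota ?add0n ?ltnS ?jn ?E.
  by rewrite eqxx.
apply: le_trans (dens_has _ _ _ _) _.
rewrite big_seq (eq_bigr (fun=> (branch d n)%:R^-1)).
  by rewrite -big_seq big_const_seq count_predT size_iota iter_addr_0 mulr_natl.
by move=> j; rewrite mem_iota => jn; rewrite dens_pos//; have := branch_gt d n; lia.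
Qed.

(** Large enough to dominate the summed exceptional densities of the later steps of the same parity,
    yet [2 * err k] stays below the least positive density of a [side d k]-periodic set. *)
Definition err k : R := ((side d k ^ d.+1 * 2 ^ k.+3)%N)%:R^-1.

Lemma err_gt0 k : 0 < err k.
Proof. by rewrite invr_gt0 ltr0n muln_gt0 !expn_gt0 side_gt0. Qed.

(** Each summand is at most a quarter of [err k]: the factor [k.+2] cancels in [branch], and the
    power of 2 has grown by 4. *)
Lemma err_step k : k.+2%:R / (branch d k.+1)%:R + err k.+2 <= err k.
Proof.
rewrite /err /branch /branching; set S1 := (side d k.+1 ^ _)%N; set S2 := (side d k.+2 ^ _)%N.
set S := (side d k ^ _)%N.
have S0 : (0 < S)%N by rewrite expn_gt0 side_gt0.
have S01 : (S <= S1)%N by rewrite leq_exp2r//; apply: leq_side; lia.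
have S02 : (S <= S2)%N by rewrite leq_exp2r//; apply: leq_side; lia.
have p0 : (0 < 2 ^ k.+3)%N by rewrite expn_gt0.
have -> : (2 ^ k.+1.+4 = 2 ^ k.+3 * 4)%N by rewrite -(expnD 2 k.+3 2); congr (2 ^ _)%N; lia.
move: (2 ^ k.+3)%N p0 => p p0.
have k0 : k.+2%:R != 0 :> R by rewrite pnatr_eq0.
have -> : k.+2%:R / (k.+2 * S1 * (p * 4))%:R = ((S1 * (p * 4))%N)%:R^-1 :> R.
  by rewrite -mulnA natrM invfM mulrA divff// mul1r.
have le S' : (S <= S')%N -> ((S' * (p * 4))%N)%:R^-1 <= (S * p)%:R^-1 / 4 :> R.
  move=> SS'; rewrite -invfM -natrM lef_pV2 ?posrE ?ltr0n; [|nia..].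
  by rewrite ler_nat; nia.
have := le _ S01; have := le _ S02.
have : 0 < (S * p)%:R^-1 :> R by rewrite invr_gt0 ltr0n muln_gt0 S0.
lra.
Qed.

(** Telescoping along one parity class by [err_step]; the second term on the left makes the
    induction close. *)
Lemma dens_conf_dist k j :
  dens R (side d (k + j.*2)) (fun t => conf k t != conf (k + j.*2) t) +
  err (k + j.*2) <= err k.
Proof.
elim: j => [|j IH].
  rewrite addn0 [dens _ _ _](_ : _ = 0) ?add0r// -[RHS](avg_cst d.+1 (side d k)).
  by apply: eq_avg => t; rewrite eqxx.
rewrite doubleS !addnS; set m := (k + _)%N in IH *.
have h : dens R (side d m.+2) (fun t => conf k t != conf m t) =
         dens R (side d m) (fun t => conf k t != conf m t).
  apply: dens_period; rewrite ?side_gt0// => t u.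
    rewrite !(periodic_dvd (side_dvd d _) (@conf_periodic d _))//; rewrite /m; lia.
  by rewrite !(periodic_dvd (side_dvd d _) (@conf_periodic d _))// /m leq_addr.
have h2 : dens R (side d m.+2) (fun t => conf m t != conf m.+2 t) <=
    m.+2%:R / (branch d m.+1)%:R.
  apply: le_trans (dens_conf_neq (n := m.+1) _) => //.
  by apply: le_dens => t; rewrite eq_sym.
have tri : dens R (side d m.+2) (fun t => conf k t != conf m.+2 t) <=
    dens R (side d m) (fun t => conf k t != conf m t) +
    m.+2%:R / (branch d m.+1)%:R.
  rewrite -h; apply: le_trans (lerD (lexx _) h2).
  exact: (dens_neq_triangle R (side d m.+2) (conf k) (conf m) (conf m.+2)).
have := err_step m; lra.
Qed.

Lemma err_cvg0 b : (fun i => err (i.*2 + b)) @ \oo --> 0.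
Proof.
apply: (@squeeze_cvgr _ _ _ _ (cst 0) (@harmonic R)); last 2 first.
- exact: cvg_cst.
- exact: cvg_harmonic.
apply: nearW => i; rewrite ltW ?err_gt0//= /err lef_pV2 ?posrE ?ltr0n//; last first.
  by rewrite muln_gt0 !expn_gt0 side_gt0.
rewrite ler_nat; set k := (_ + b)%N.
have s0 : (0 < side d k ^ d.+1)%N by rewrite expn_gt0 side_gt0.
apply: leq_trans (leq_pmull _ s0); apply: leq_trans (ltn_expl _ _) => //.
by rewrite /k; lia.
Qed.

Lemma conf_besicovitch (b : nat) : besicovitch_cauchy (fun i => conf (d := d) (i.*2 + b))
  (fun i => side d (i.*2 + b)) (fun i => err (i.*2 + b)).
Proof.
split.
- by move=> k; exact: side_gt0.
- by move=> k m km; apply: side_dvd; lia.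
- by move=> k; exact: conf_periodic.
- move=> k m km; have := dens_conf_dist (k.*2 + b) (m - k).
  have -> : (k.*2 + b + (m - k).*2 = m.*2 + b)%N by lia.
  by have := err_gt0 (m.*2 + b); lra.
- exact: err_cvg0.
Qed.

(** By periodicity a single disagreement already has density at least the inverse of
    [side d k ^ d.+1]. *)
Lemma dens_aperiodic k g t : conf k (t + g) <> conf k t ->
  2 * err k < dens R (side d k) (fun t => conf k t != conf k (t + g)).
Proof.
move=> /eqP diff; pose f s : R := (conf k s != conf k (s + g))%:R.
have pf : lattice_periodic (side d k) f.
  by move=> s u; rewrite /f addrAC !conf_periodic.
have := avg_ge_point t (side_gt0 d k) pf (fun s => ler0n _ _).
rewrite {1}/f eq_sym diff /= => /lt_le_trans; apply.
rewrite card_box ?side_gt0// /err natrM invfM mul1r.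
set S := (side d k ^ _)%N.
have S0 : 0 < S%:R^-1 :> R by rewrite invr_gt0 ltr0n expn_gt0 side_gt0.
rewrite mulrCA gtr_pMr//.
have -> : (2 ^ k.+3 = 2 * 2 ^ k.+2)%N by rewrite expnS.
rewrite natrM invfM mulrA divff ?pnatr_eq0// mul1r invf_lt1 ?ltr0n ?expn_gt0//.
by rewrite ltr1n (leq_trans _ (ltn_expl k.+2 _)).
Qed.

End densities.

(** * The subshift, its CAM property and its two measures *)

Section system.
Variable d : nat.
Implicit Types (t s u v g : Zd d.+1) (i : 'I_d.+1) (n m k N : nat).

Definition orbits : set (Conf d.+1) :=
  [set x | exists k t, x = Defs.shift t (conf k)].

Definition system : set (Conf d.+1) := closure orbits.

Lemma system_closed : closed system. Proof. exact: closed_closure. Qed.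

Lemma system_orbit k t : system (Defs.shift t (conf k)).
Proof. by apply: subset_closure; exists k, t. Qed.

Lemma system_shift_invariant : shift_invariant system.
Proof.
move=> v _ [x Xx <-] B /shift_continuous/Xx[_ [[k [t ->]] Bx]].
by exists (Defs.shift v (Defs.shift t (conf k))); split=> //; exists k, (v + t); rewrite shiftD.
Qed.

Lemma system_open (U : set (Conf d.+1)) : open U -> U `&` system !=set0 ->
  exists k t, U (Defs.shift t (conf k)).
Proof.
move=> oU [x [Ux Xx]].
have [_ [[k [t ->]] Uk]] := Xx U (open_nbhs_nbhs (conj oU Ux)).
by exists k, t.
Qed.

(** Membership in [U] near an orbit point is decided by a finite pattern, and [pattern_occurs] finds
    it in every later [conf j]. Two open sets thus meet a common orbit, which gives transitivity. *)
Lemma conf_meets_open (U : set (Conf d.+1)) : open U -> U `&` system !=set0 ->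
  exists M, forall j, (M <= j)%N -> exists v, U (Defs.shift v (conf j)).
Proof.
move=> oU /(system_open oU)[k [t Ut]].
have [W WU] := nbhs_agreeP (open_nbhs_nbhs (conj oU Ut)).
have [M MW] := pattern_occurs W k t; exists M => j /MW/(_ 0)[v vW].
exists v; apply: WU => u uW; rewrite /Defs.shift addrC [u + v]addrC.
by have [_ ->] := vW u uW.
Qed.

Lemma system_transitive : sub_transitive system.
Proof.
move=> U V oU oV /(conf_meets_open oU)[M MU] /(conf_meets_open oV)[M' MV].
have [v Uv] := MU _ (leq_maxl M M'); have [w Vw] := MV _ (leq_maxr M M').
exists (w - v), (Defs.shift w (conf (maxn M M'))); split; last first.
  by split=> //; exact: system_orbit.
exists (Defs.shift v (conf (maxn M M'))); first by split=> //; exact: system_orbit.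
by rewrite shiftD subrK.
Qed.

(** By [conf_aperiodic], two successive configurations of one parity cannot both be [g]-invariant
    once the side exceeds a nonzero coordinate of [g]. *)
Lemma exists_aperiodic g b : g != 0 ->
  exists k t, conf (k.*2 + b) (t + g) <> conf (k.*2 + b) t.
Proof.
move=> g0; have [i gi] : exists i, g ord0 i != 0.
  apply/existsP; apply: contraNT g0; rewrite negb_exists => /forallP gE.
  by apply/eqP/rowP => i; rewrite mxE; apply/eqP/negPn.
pose k := (`|g ord0 i|%N).
have gk : (`|g ord0 i|%N <= side d (k.*2 + b).+1)%N.
  by apply: ltnW; apply: leq_ltn_trans (side_gt d _); rewrite /k; lia.
have [/existsNP[t nt]|] := pselect (~ forall t, conf (k.*2 + b) (t + g) = conf (k.*2 + b) t).
  by exists k, t.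
move=> /contrapT pk; have [/existsNP[t nt]|] :=
  pselect (~ forall t, conf (k.*2 + b).+2 (t + g) = conf (k.*2 + b).+2 t).
  by exists k.+1, t.
by move=> /contrapT pk2; have := conf_aperiodic gi gk; case.
Qed.

Lemma system_faithful : sub_faithful system.
Proof.
move=> g gX; apply/eqP/negPn/negP => /(exists_aperiodic 0)[k [t]]; apply.
have := gX _ (@system_orbit (k.*2 + 0)%N 0); rewrite Conf_shift0.
by move=> /(congr1 (@^~ t)).
Qed.

Lemma shift_mod (L : nat) (x : Conf d.+1) t : (0 < L)%N ->
  lattice_periodic L (x : Zd d.+1 -> bool) ->
  exists w : box d.+1 L, Defs.shift t x = Defs.shift (corner w) x.
Proof.
move=> L0 px; have [w [a ->]] := mod_box t L0; exists w.
by apply/funext => u; rewrite /Defs.shift addrA px.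
Qed.

Lemma conf_periodic_pt k t : periodic_pt (Defs.shift t (conf (d := d) k)).
Proof.
apply: (@sub_finite_set _ _ [set Defs.shift (corner w) (conf k) | w in [set: box d.+1 (side d k)]]).
  move=> _ [g _ <-]; rewrite shiftD.
  have [w ->] := shift_mod (g + t) (side_gt0 d k) (@conf_periodic d k).
  by exists w.
exact/finite_image/finite_finset.
Qed.

Lemma system_dense_periodic : sub_dense_periodic system.
Proof.
move=> U oU /(system_open oU)[k [t Ut]]; exists (Defs.shift t (conf k)).
  by split=> //; exact: system_orbit.
exact: conf_periodic_pt.
Qed.

Definition window (K : nat) : set (Zd d.+1) :=
  [set u | forall i, (`|u ord0 i|%N <= K)%N].

Lemma window_agree (x : Conf d.+1) K : system x ->
  exists n s, forall u, window K u -> x u = conf n (s + u).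
Proof.
move=> Xx.
(* The window listed as a box of side [K.*2.+1] recentred at the origin. *)
pose W : seq (Zd d.+1) := [seq corner w - \row__ (K%:Z) | w <- enum {: box d.+1 K.*2.+1}].
have [_ [[n [s ->]] agree]] := Xx _ (nbhs_agree x W).
exists n, s => u uK; rewrite agree /Defs.shift ?[s + u]addrC//.
apply/mapP; exists (\row_i inord `|(u ord0 i + K%:Z)%R|%N); first by rewrite mem_enum.
apply/rowP => i; have ui := uK i; rewrite -[LHS]/(u ord0 i) !mxE inordK.
  by lia.
by rewrite /=; lia.
Qed.

(* Cells of [conf N] and [conf N.-1] contain the pattern, so [idx] stays below
   [N.-1] on the window, and there it cannot change between neighbours. *)
Lemma avoiding_window (W : seq (Zd d.+1)) m t : exists N, forall x : Conf d.+1,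
  system x -> (forall v, exists2 u, u \in W & x (v + u) != conf m (t + u)) ->
  forall K, exists j (w : box d.+1 (side d N)), (j < N)%N /\
    forall u, window K u -> x u = conf j (corner w + u).
Proof.
have [M MW] := pattern_occurs W m t; exists M.+2; set N := M.+2 => x Xx avoid K.
(* A pattern located in the level-[N] cell of a point of the window may stick out of it by less than
   [side d N]. *)
have [n [s xs]] := window_agree (K + side d N) Xx.
have N0 : (0 < N)%N by [].
have small s' : (forall i, `|s' ord0 i - s ord0 i|%N <= K)%N -> (idx N n s' < N.-1)%N.
  move=> s'K; rewrite ltnNge; apply/negP => jN; set j := idx N n s' in jN.
  have Mj : (M <= j)%N by rewrite /N in jN; lia.
  have [v vW] := MW j Mj s'.
  have [u uW] := avoid (v - s); apply/negP/negPn/eqP.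
  have [cE <-] := vW u uW.
  have cN : cell N (v + u) =1 cell N s'.
    by apply: cell_coarsen cE; exact: idx_le.
  have -> : v - s + u = v + u - s by rewrite addrAC.
  rewrite xs; first by rewrite addrC subrK (conf_idx n (v + u) N0) (idx_cell n cN).
  move=> i; have := cN i; rewrite /cell => cNi.
  have := divz_eq ((v + u) ord0 i) (side d N); have := divz_eq (s' ord0 i) (side d N).
  have sN : (side d N)%:Z != 0 by have := side_gt0 d N; lia.
  have := modz_ge0 ((v + u) ord0 i) sN; have := ltz_mod ((v + u) ord0 i) sN.
  have := modz_ge0 (s' ord0 i) sN; have := ltz_mod (s' ord0 i) sN.
  rewrite cNi; have -> : (v + u - s) ord0 i = (v + u) ord0 i - s ord0 i by rewrite !mxE.
  have := s'K i; move: ((v + u) ord0 i) (s' ord0 i) (s ord0 i) => a b c.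
  move: (b %/ side d N)%Z (a %% side d N)%Z (b %% side d N)%Z => q ra rb.
  by move: (side d N)%N => S; move: (q * S) => qS; lia.
have sK0 : forall i, (`|s ord0 i - s ord0 i|%N <= K)%N by move=> i; rewrite subrr.
exists (idx N n s); have [w [a wE]] := mod_box s (side_gt0 d N); exists w; split.
  by have := small s sK0; lia.
move=> u uK; rewrite xs; last by move=> i; have := uK i; lia.
have suK i : (`|((s + u) ord0 i - s ord0 i)%R|%N <= K)%N.
  by rewrite mxE addrAC subrr add0r; exact: uK.
rewrite (conf_idx n (s + u) N0) (idx_connected N0 small suK).
rewrite wE addrAC (periodic_dvd _ (@conf_periodic d _))//.
exact/side_dvd/idx_le.
Qed.

(** An orbit point outside [Y] yields a pattern that no point of [Y] contains, and [avoiding_window]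
    leaves only the finitely many candidates [F jw]. *)
Lemma system_proper_finite : proper_closed_invariant_finite system.
Proof.
move=> Y YX nYX cY invY.
have [x0 Xx0 nYx0] : exists2 x, system x & ~ Y x.
  apply: contrapT => h; apply: nYX; apply/seteqP; split => // x Xx.
  by apply: contrapT => nYx; apply: h; exists x.
have [m [t nYm]] : exists k t, (~` Y) (Defs.shift t (conf k)).
  by apply: system_open; [exact: closed_openC|exists x0].
have [W WY] := nbhs_agreeP (open_nbhs_nbhs (conj (closed_openC cY) nYm)).
have [N NW] := avoiding_window W m t.
pose F (jw : 'I_N * box d.+1 (side d N)) : Conf d.+1 :=
  Defs.shift (corner jw.2) (conf jw.1).
apply: (@sub_finite_set _ _ [set F jw | jw in setT]); last exact/finite_image/finite_finset.
move=> y Yy.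
have avoid v : exists2 u, u \in W & y (v + u) != conf m (t + u).
  apply: contrapT => h; have : (~` Y) (Defs.shift v y).
    apply: WY => u uW; rewrite /Defs.shift [u + t]addrC [u + v]addrC.
    apply: contrapT => ne; apply: h; exists u => //.
    by apply/eqP => e; apply: ne; rewrite e.
  by apply; apply: (invY v); exists y.
have win := NW y (YX _ Yy) avoid.
(* Each window admits a candidate agreeing with [y], possibly depending on the window. If [y]
   differed from all candidates, a window containing one disagreement with each would admit none. *)
apply: contrapT => nF.
have bad jw : exists K, exists2 u, window K u & y u != F jw u.
  apply: contrapT => h; apply: nF; exists jw => //; apply/funext => u.
  apply: contrapT => ne; apply: h; exists (\max_i `|u ord0 i|%N)%N, u.
    by move=> i; exact: leq_bigmax.
  by apply/eqP => e; apply: ne; rewrite e.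
have [K KP] := choice bad.
have [j [w [jN jE]]] := win (\max_jw K jw)%N.
have [u uK] := KP (Ordinal jN, w).
rewrite jE /F /Defs.shift /= ?[u + _]addrC ?eqxx//.
by move=> i; apply: leq_trans (uK i) _; exact: leq_bigmax.
Qed.

Lemma system_CAM : CAM system.
Proof.
split; [split|exact: system_dense_periodic|exact: system_proper_finite].
- exact: system_transitive.
- exact: system_faithful.
Qed.

(** The parity of [b] selects the limit. The frequency bound, which is [pr_occ_dist] at the first
    term with a one-point window, serves to tell the two limits apart. *)
Lemma system_measure (R : realType) (b : nat) :
  exists mu : probability (Borel d.+1) R, nonatomic_ergodic_on system mu /\
    `|pr mu [set x : Conf d.+1 | x 0] - dens R (side d b) (conf (d := d) b)| <= err R d b.
Proof.
have Hb := conf_besicovitch R d b.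
have [mu mulim] := limit_measure_exists Hb; exists mu; split; last first.
  have det : determined [:: 0] [set x : Conf d.+1 | x 0].
    by move=> x y xy /=; rewrite xy ?inE.
  have := pr_occ_dist Hb mulim 0 det; rewrite mul1r /= add0n.
  congr (`|_ - _| <= _); apply: eq_avg => t.
  by rewrite /Defs.shift /= add0r asboolb.
split.
- by apply: (limit_supported mulim system_closed) => k t; exact: system_orbit.
- exact: (limit_invariant Hb mulim).
- exact: (limit_ergodic Hb mulim).
- apply: (limit_nonatomic Hb mulim) => // g /(exists_aperiodic b)[k [t nt]].
  by exists k; exact: dens_aperiodic nt.
Qed.

End system.

Theorem theorem1p2 (R : realType) (d : nat) (hd : (1 <= d)%N) :
  exists X : set (Conf d),
    [/\ closed X, shift_invariant X, CAM X &
      exists mu1 mu2 : probability (Borel d) R,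
        [/\ nonatomic_ergodic_on X mu1, nonatomic_ergodic_on X mu2 &
            exists2 A : set (Borel d), measurable A & mu1 A <> mu2 A]].
Proof.
case: d hd => // d _; exists (@system d); split.
- exact: system_closed.
- exact: system_shift_invariant.
- exact: system_CAM.
have [mu1 [H1 l1]] := system_measure d R 0; have [mu2 [H2 l2]] := system_measure d R 1.
exists mu1, mu2; split=> //; exists [set x : Conf d.+1 | x 0].
  by apply: cylinder_measurable; exists [:: 0] => x y xy /=; rewrite xy ?inE.
move=> E; move: l1 l2; rewrite {1 2}/pr E {E}.
have -> : dens R (side d 0) (conf (d := d) 0) = 0.
  by rewrite -[RHS](avg_cst d.+1 (side d 0)); apply: eq_avg => t; rewrite conf0.
have -> : dens R (side d 1) (conf (d := d) 1) = 1.
  by rewrite -[RHS](avg_cst d.+1 (side d 1)); apply: eq_avg => t; rewrite conf1.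
(* If both measures gave the symbol 1 the same frequency, it would lie within 1/8 of 0 and of 1. *)
have err8 k : err R d k <= 8^-1.
  rewrite /err lef_pV2 ?posrE//; last by rewrite -invr_gt0; exact: err_gt0.
  rewrite ler_nat (@leq_trans (2 ^ k.+3)%N)//; first exact: (@leq_pexp2l 2 3).
  by rewrite leq_pmull// expn_gt0 side_gt0.
have := err8 0%N; have := err8 1%N; move: (err R d 0) (err R d 1) => e0 e1.
by rewrite !ler_norml => ? ? /andP[? ?] /andP[? ?]; lra.
Qed.
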